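(* Let $k\geq 8$ be an integer. There exists $n_0=n_0(k)$ such that for every $n\geq n_0$ the following holds. Let $\mathcal{T}$ be the set of all trees of order $2k+3$ and diameter at most four, except for $S_{2,\ldots,2}$. If $G$ is a graph of order $n$ with $\mu(G)\geq \mu(S_{n,k})$ and $G\neq S_{n,k}$, then $G$ contains every tree in $\mathcal{T}$ as a subgraph.
   Context: All graphs are simple and undirected. $\mu(G)$ denotes the spectral radius (largest eigenvalue of the adjacency matrix) of $G$. $S_{n,k}=K_k\vee\overline{K_{n-k}}$ is the graph obtained by joining every vertex of a complete graph $K_k$ to every vertex of an independent set of $n-k$ vertices. $S_{2,\ldots,2}$ is the tree of order $2k+3$ obtained from the star $K_{1,k+1}$ by subdividing each of its $k+1$ edges exactly once. ''Contains'' means contains as a (not necessarily induced) subgraph. *)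

(* Defs.v *)
From HB Require Import structures.
From mathcomp Require Import all_boot all_order all_algebra.
From mathcomp Require Import all_classical all_reals.
Set Implicit Arguments.
Unset Strict Implicit.
Unset Printing Implicit Defensive.
Import Order.TTheory GRing.Theory Num.Theory.

Record sgraph := SGraph {
  vertex :> finType;
  adj : rel vertex;
  adj_sym : symmetric adj;
  adj_irrefl : irreflexive adj }.
Arguments adj {s} x y.

Definition isomorphic (G H : sgraph) : Prop :=
  exists2 f : G -> H, bijective f & {mono f : x y / adj x y}.

(* [H] is a (not necessarily induced) subgraph of [G]. *)
Definition contains (G H : sgraph) : Prop :=
  exists2 f : H -> G, injective f & {homo f : x y / adj x y}.

Section Complete.
Variable n : nat.

Definition complete_rel : rel 'I_n := fun i j => i != j.

Lemma complete_sym : symmetric complete_rel.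
Proof. by move=> i j; rewrite /complete_rel eq_sym. Qed.

Lemma complete_irrefl : irreflexive complete_rel.
Proof. by move=> i; rewrite /complete_rel eqxx. Qed.

Definition complete_graph : sgraph := SGraph complete_sym complete_irrefl.
End Complete.

Section Complement.
Variable G : sgraph.

Definition compl_rel : rel G := fun x y => (x != y) && ~~ adj x y.

Lemma compl_sym : symmetric compl_rel.
Proof. by move=> x y; rewrite /compl_rel eq_sym adj_sym. Qed.

Lemma compl_irrefl : irreflexive compl_rel.
Proof. by move=> x; rewrite /compl_rel eqxx. Qed.

Definition compl_graph : sgraph := SGraph compl_sym compl_irrefl.
End Complement.

Section Join.
Variables G H : sgraph.

Definition join_rel : rel (G + H)%type := fun u v =>
  match u, v with
  | inl x, inl y => adj x y
  | inr x, inr y => adj x y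
  | _, _ => true
  end.

Lemma join_sym : symmetric join_rel.
Proof. by move=> [x|x] [y|y] //=; rewrite adj_sym. Qed.

Lemma join_irrefl : irreflexive join_rel.
Proof. by move=> [x|x] /=; rewrite adj_irrefl. Qed.

Definition graph_join : sgraph := SGraph join_sym join_irrefl.
End Join.

Section Subdivision.
Variable G : sgraph.

Definition edge_set : {set {set G}} :=
  [set [set p.1; p.2] | p : G * G & adj p.1 p.2].

(* Every edge [e] becomes a new vertex joined to the two endpoints of [e]. *)
Definition subdivision_rel : rel (G + {e : {set G} | e \in edge_set})%type :=
  fun u v =>
  match u, v with
  | inl x, inr e => x \in val e
  | inr e, inl x => x \in val e
  | _, _ => false
  end.

Lemma subdivision_sym : symmetric subdivision_rel.
Proof. by move=> [x|x] [y|y]. Qed.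

Lemma subdivision_irrefl : irreflexive subdivision_rel.
Proof. by move=> [x|x]. Qed.

Definition subdivision : sgraph := SGraph subdivision_sym subdivision_irrefl.
End Subdivision.

(* [S_{n,k}]; because of the truncated subtraction it has order [n] only when
   [k <= n]. *)
Definition S_graph (n k : nat) : sgraph :=
  graph_join (complete_graph k) (compl_graph (complete_graph (n - k))).

(* [K_{1,m}] *)
Definition star (m : nat) : sgraph :=
  graph_join (complete_graph 1) (compl_graph (complete_graph m)).

(* [S_{2,...,2}], of order [2k+3] *)
Definition spider2 (k : nat) : sgraph := subdivision (star k.+1).

Definition connected_graph (G : sgraph) : Prop :=
  forall x y : G, connect (@adj G) x y.

Definition acyclic (G : sgraph) : Prop :=
  forall c : seq G, ucycle (@adj G) c -> size c <= 2.

Definition is_tree (G : sgraph) : Prop :=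
  [/\ 0 < #|G|, connected_graph G & acyclic G].

Definition has_walk (G : sgraph) (x y : G) (d : nat) : bool :=
  [exists p : d.-tuple G, path adj x p && (last x p == y)].

(* Vertices in the same component are at distance less than [#|G|], so the
   search over [0, ..., #|G| - 1] is exhaustive; the value is [#|G|] when [y]
   cannot be reached from [x]. *)
Definition dist (G : sgraph) (x y : G) : nat :=
  find (has_walk x y) (iota 0 #|G|).

(* Meaningful for connected graphs only. *)
Definition diameter (G : sgraph) : nat := \max_(x : G) \max_(y : G) dist x y.

Definition tree_family (k : nat) (T : sgraph) : Prop :=
  [/\ is_tree T, #|T| = 2 * k + 3, diameter T <= 4
    & ~ isomorphic T (spider2 k)].

Local Open Scope ring_scope.

Definition adjmx (R : realType) (G : sgraph) : 'M[R]_#|G| :=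
  \matrix_(i, j) (adj (enum_val i) (enum_val j))%:R.

(* The largest eigenvalue of the adjacency matrix: for nonempty [G] the set of
   real eigenvalues is finite, and nonempty since [adjmx R G] is symmetric, so
   the supremum is a maximum. *)
Definition mu (R : realType) (G : sgraph) : R :=
  sup [set a : R | eigenvalue (adjmx R G) a]%classic.

(* Main.v *)
Require Import Defs.
From mathcomp Require Import all_boot all_order all_algebra.
From mathcomp Require Import all_classical all_reals.
From mathcomp Require Import zify ring lra.
(* [fintype] and [finset] again: [all_classical] shadows [set0], [subsetP], ... *)
From mathcomp Require Import fintype finset.
Set Implicit Arguments.
Unset Strict Implicit.
Unset Printing Implicit Defensive.

(** Let [t = 2k + 3] and let [G] be a [T]-free graph with [mu G >= mu S_{n,k}].
    A tree [T] of the family has a colour class of at most [k + 1] vertices,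
    and if there are exactly [k + 1] of them, one is a leaf: otherwise all have
    degree two, [T] is the subdivision of a tree, and the bound on the diameter
    makes that tree a star.  Hence [G] contains neither [K_{k+1,t}] nor
    [K_{k,t+2}] with an edge added in the large class; moreover every vertex set
    [U] of [G] spans at most [t #|U|] edges.

    Normalise the absolute value [x] of an eigenvector for [mu G] to have
    maximum 1; it satisfies [mu x <= A x].  Counting two-step walks with these
    sparsity facts shows that exactly [k] vertices [L] have [x] close to 1, that
    almost all vertices are joined to all of [L], and that [x] is small off [L].
    The common neighbourhood of [L] is then independent.  Finally pair [x] with
    the Perron vector of [S_{n,k}]: each vertex [v] outside [L] that misses a
    neighbour in [L] loses about [k], while the edges at such vertices
    can only regain [O(t k max x)] on average, so there is no such vertex, [L] is
    a clique and [G = S_{n,k}]. *)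

(** * Embedding trees *)

Section TreeOrder.
Variable T : sgraph.

(** The list is read from its end: each head is attached as a leaf to the tree on the tail, with [w]
    as its only neighbour there. Facts about trees become inductions on lists. *)
Inductive tree_order : seq T -> Prop :=
| TreeOrder1 v : tree_order [:: v]
| TreeOrderS v w s : tree_order s -> v \notin s -> w \in s -> adj v w ->
    (forall u, u \in s -> adj v u -> u = w) -> tree_order (v :: s).

Lemma tree_order_uniq s : tree_order s -> uniq s.
Proof. by elim=> // v w s' _ us vs _ _ _ /=; rewrite vs. Qed.

Lemma tree_order_path s : tree_order s -> {in s &, forall x y,
  exists p, [/\ path adj x p, last x p = y & {subset p <= s}]}.
Proof.
elim=> [v x y|v w {}s _ IH vs ws vw _ x y].
  by rewrite !inE => /eqP-> /eqP->; exists [::].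
rewrite !inE => /orP[/eqP->|xs] /orP[/eqP->|ys].
- by exists [::].
- have [p [px py ps]] := IH _ _ ws ys.
  exists (w :: p); split=> //=; first by rewrite vw.
  by move=> z; rewrite !inE => /orP[/eqP->|/ps->]; rewrite ?ws orbT.
- have [p [px py ps]] := IH _ _ xs ws.
  exists (rcons p v); split; rewrite ?last_rcons //.
    by rewrite rcons_path px py adj_sym.
  by move=> z; rewrite mem_rcons !inE => /orP[->//|/ps->]; rewrite orbT.
- have [p [px py ps]] := IH _ _ xs ys.
  by exists p; split=> // z /ps zs; rewrite inE zs orbT.
Qed.

(** Connectedness gives an edge from [s] to an outside vertex [v]; a second neighbour of [v] in [s]
    would close a cycle through the path inside [s] that joins the two. *)
Lemma tree_order_extend s : is_tree T -> tree_order s -> size s < #|T| ->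
  exists v, tree_order (v :: s).
Proof.
move=> [_ Tconn Tacyc] os ss.
have [x xs] : exists x, x \in s.
  by case: os => [v|v w s' *]; exists v; rewrite inE eqxx.
have [y ys] : exists y, y \notin s.
  apply/existsP; rewrite -negb_forall; apply/negP => /forallP allin.
  have: #|T| <= #|s| by apply/subset_leq_card/subsetP => z _; apply: allin.
  by rewrite leqNgt (leq_ltn_trans (card_size s) ss).
have [v [w [vs ws vw]]] : exists v w, [/\ v \notin s, w \in s & adj v w].
  apply: contrapT => H.
  suff cl : closed adj (mem s) by rewrite -(closed_connect cl (Tconn x y)) xs in ys.
  move=> a b ab; case: (boolP (a \in s)) => as_; case: (boolP (b \in s)) => bs //.
  - by case: H; exists b, a; rewrite adj_sym.
  - by case: H; exists a, b.
exists v; apply: (TreeOrderS os vs ws vw) => u us vu.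
apply/eqP; apply: contraT => uw.
have [p [px py ps]] := tree_order_path os ws us.
case/shortenP: px py => q qx uq sq py.
have: ucycle adj (v :: w :: q).
  apply/andP; split.
    rewrite /cycle rcons_path /= vw qx /=.
    by rewrite py adj_sym.
  rewrite cons_uniq uq andbT inE negb_or; apply/andP; split.
    by apply: contraNneq vs => ->.
  by apply: contra vs => /sq /ps.
move/Tacyc; case: q {qx uq sq} py => //= uw'.
by rewrite uw' eqxx in uw.
Qed.

Lemma tree_order_full : is_tree T ->
  exists s, [/\ tree_order s, s =i predT & size s = #|T|].
Proof.
move=> tT; have [/card_gt0P[x _] _ _] := tT.
suff H n : 0 < n <= #|T| -> exists2 s, tree_order s & size s = n.
  have [|s os ss] := H #|T|; first by rewrite leqnn andbT; case: tT.
  exists s; split=> //; have cs : #|s| = #|T|.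
    by rewrite (card_uniqP (tree_order_uniq os)).
  by apply/(subset_cardP cs)/subsetP.
elim: n => // -[_ _|n IH /andP[_ le]]; first by exists [:: x] => //; constructor.
have [|s os ss] := IH; first by exact: ltnW.
have [|v ov] := tree_order_extend tT os; first by rewrite ss.
by exists (v :: s) => //=; rewrite ss.
Qed.

Lemma tree_order_coloring s : tree_order s ->
  exists c : T -> bool, {in s &, forall u v, adj u v -> c u != c v}.
Proof.
elim=> [v|v w {}s _ [c cP] vs ws vw vu].
  by exists xpred0 => x y; rewrite !inE => /eqP-> /eqP->; rewrite adj_irrefl.
exists (fun x => if x == v then ~~ c w else c x) => x y.
have neqv z : z \in s -> (z == v) = false by apply: contraTF => /eqP->.
rewrite !inE => /orP[/eqP->|xs] /orP[/eqP->|ys]; rewrite ?eqxx ?adj_irrefl //.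
- by rewrite neqv // => /(vu _ ys)->; case: (c w).
- by rewrite neqv // adj_sym => /(vu _ xs)->; case: (c w).
- by rewrite !neqv //; apply: cP.
Qed.

(** Each edge has exactly one end of colour [c], so the degrees in that class count the edges, and
    every attached leaf brings one edge. *)
Lemma tree_order_degree_sum (c : T -> bool) s : tree_order s ->
  {in s &, forall u v, adj u v -> c u != c v} ->
  \sum_(u <- s | c u) count (adj u) s = (size s).-1.
Proof.
elim=> [v|v w {}s os IH vs ws vw vu] cP.
  by rewrite big_mkcond big_seq1 /= adj_irrefl; case: ifP.
have /IH {}IH : {in s &, forall u v, adj u v -> c u != c v}.
  by move=> a b as_ bs; apply: cP; rewrite inE ?as_ ?bs orbT.
have cvw : c v != c w by apply: cP; rewrite ?inE ?eqxx ?ws ?orbT.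
have us := tree_order_uniq os.
have cnt : count (adj v) s = 1.
  rewrite (eq_in_count (a2 := pred1 w)); first by rewrite count_uniq_mem // ws.
  by move=> u us' /=; apply/idP/eqP => [/vu->|->].
have s0 : 0 < size s by case: (s) ws.
rewrite big_cons /= adj_irrefl add0n cnt.
rewrite (eq_bigr (fun u => adj u v + count (adj u) s)) // big_split /= IH.
(* The leaf [v] raises only the degree of [w]; since [v] and [w] differ in colour, exactly one of
   them contributes the new edge. *)
have -> : \sum_(u <- s | c u) adj u v = c w.
  rewrite big_seq_cond (eq_bigr (fun u => (u == w : nat))); last first.
    move=> u /andP[us' _]; congr nat_of_bool; rewrite adj_sym.
    by apply/idP/eqP => [/vu->|->].
  rewrite -big_seq_cond -big_mkcondl sum1_count /=.
  case: (boolP (c w)) => cw.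
    rewrite (eq_count (a2 := pred1 w)) ?count_uniq_mem ?ws // => u /=.
    by case: (u =P w) => [->|//]; rewrite cw.
  rewrite (eq_count (a2 := pred0)) ?count_pred0 // => u /=.
  by case: (u =P w) => [->|//]; rewrite (negPf cw).
by move: cvw; case: (c v); case: (c w) => // _; rewrite ?add1n ?add0n ?addn0 prednK.
Qed.

(** Greedy embedding: the images of [s] occupy at most [size s] vertices, fewer than the neighbours
    in [U] of the image of [w], so a free one remains for the leaf [v]. *)
Lemma tree_order_embed (H : sgraph) (U : {set H}) s : tree_order s ->
  0 < #|U| -> {in U, forall u, size s <= #|[set w in U | adj u w]|} ->
  exists f : T -> H, [/\ {in s, forall x, f x \in U}, {in s &, injective f}
    & {in s &, {homo f : x y / adj x y}}].
Proof.
move=> os /card_gt0P[u0 u0U].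
elim: os => [v|v w {}s os IH vs ws vw vu] deg.
  exists (fun=> u0); split=> //; first by move=> x y; rewrite !inE => /eqP-> /eqP->.
  by move=> x y; rewrite !inE => /eqP-> /eqP->; rewrite adj_irrefl.
have [|f [fU fi fh]] := IH; first by move=> u /deg; apply: ltnW.
have [y yP] : exists y, y \in [set z in U | adj (f w) z] :\: [set z in map f s].
  apply/card_gt0P; rewrite -(ltn_add2r #|[set z in map f s]|) add0n.
  apply: (@leq_trans (size s).+1).
    by rewrite ltnS -(size_map f) cardsE card_size.
  apply: (leq_trans (deg _ (fU _ ws))).
  rewrite -(cardsID [set z in map f s]) addnC leq_add2l.
  by apply/subset_leq_card/subsetIr.
move: yP; rewrite !inE => /andP[ys /andP[yU fwy]].
exists (fun x => if x == v then y else f x).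
have neqv z : z \in s -> (z == v) = false by apply: contraTF => /eqP->.
have fy z : z \in s -> (f z == y) = false.
  by move=> zs; apply: contraNF ys => /eqP<-; apply: map_f.
split.
- by move=> x; rewrite inE => /orP[/eqP->|xs]; rewrite ?eqxx ?neqv // fU.
- move=> a b; rewrite !inE => /orP[/eqP->|as_] /orP[/eqP->|bs]; rewrite ?eqxx ?neqv //.
  + by move/eqP; rewrite eq_sym fy.
  + by move/eqP; rewrite fy.
  + exact: fi.
- move=> a b; rewrite !inE => /orP[/eqP->|as_] /orP[/eqP->|bs];
    rewrite ?eqxx ?neqv ?adj_irrefl //.
  + by move=> /(vu _ bs)->; rewrite adj_sym.
  + by rewrite adj_sym => /(vu _ as_)->.
  + exact: fh.
Qed.

End TreeOrder.

(** * Sparsity and embeddings into complete bipartite graphs *)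

Definition nbhd (G : sgraph) (v : G) : {set G} := [set u | adj v u].

Definition common_nbhd (G : sgraph) (Y : {set G}) : {set G} :=
  [set v | Y \subset nbhd v].

Lemma in_nbhd (G : sgraph) (u v : G) : (u \in nbhd v) = adj v u.
Proof. by rewrite inE. Qed.

Lemma common_nbhd_adj (G : sgraph) (Y : {set G}) u v :
  u \in Y -> v \in common_nbhd Y -> adj u v.
Proof. by move=> uY; rewrite inE => /subsetP/(_ _ uY); rewrite inE adj_sym. Qed.

Lemma common_nbhd_disjoint (G : sgraph) (Y : {set G}) v :
  v \in common_nbhd Y -> v \notin Y.
Proof.
by move=> vC; apply/negP => vY; have := common_nbhd_adj vY vC; rewrite adj_irrefl.
Qed.

(** If all degrees inside [U] are at least [#|T|], the tree embeds greedily; otherwise a vertex of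
    smaller degree is deleted and induction applies. The sum counts every edge inside [U] twice. *)
Lemma edges_extremal (G T : sgraph) (U : {set G}) : is_tree T -> ~ contains G T ->
  \sum_(u in U) #|nbhd u :&: U| <= 2 * #|T| * #|U|.
Proof.
move=> tT nGT; have [s [os sT ss]] := tree_order_full tT.
have [n] := ubnP #|U|; elim: n U => // n IH U; rewrite ltnS => leUn.
have [->|U0] := eqVneq U set0; first by rewrite big_set0.
case: (boolP [forall u in U, #|T| <= #|nbhd u :&: U|]) => [/forall_inP deg|].
  case: nGT; have [||f [_ fi fh]] := @tree_order_embed T G U s os.
  - by rewrite card_gt0.
  - move=> u /deg; rewrite ss => /leq_trans; apply.
    by apply/subset_leq_card/subsetP => w; rewrite !inE andbC.
  by exists f => x y; [apply: fi|apply: fh]; rewrite sT.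
rewrite negb_forall_in => /exists_inP[u uU]; rewrite -ltnNge => du.
have cU : #|U| = (#|U :\ u|).+1 by rewrite (cardsD1 u) uU.
have /IH : #|U :\ u| < n by rewrite -cU.
rewrite (big_setD1 u uU) /= => IHu.
(* The degree of [u] is lost twice: as its own term, split off above, and once more through its
   neighbours. *)
have -> : \sum_(v in U :\ u) #|nbhd v :&: U| =
    \sum_(v in U :\ u) #|nbhd v :&: (U :\ u)| + #|nbhd u :&: U|.
  rewrite (eq_bigr (fun v => #|nbhd v :&: (U :\ u)| + adj v u)); last first.
    move=> v _; rewrite (cardsD1 u (nbhd v :&: U)) addnC !inE uU andbT.
    by congr (_ + _); apply: eq_card => w; rewrite !inE andbCA.
  rewrite big_split /=; congr (_ + _).
  rewrite -big_mkcondr sum1_card; apply: eq_card => v.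
  rewrite !inE unfold_in /= !inE adj_sym andbC.
  by case: (v =P u) => [->|]; rewrite ?adj_irrefl.
rewrite cU mulnS; have arith (a d e m : nat) : a <= e -> d < m -> d + (a + d) <= 2 * m + e by lia.
exact: arith IHu du.
Qed.

Lemma exists_injection (A B : finType) (X : {set A}) (Y : {set B}) (b : B) :
  #|X| <= #|Y| -> exists f : A -> B, {in X, forall x, f x \in Y} /\ {in X &, injective f}.
Proof.
move=> XY; have lt x : x \in X -> index x (enum X) < size (enum Y).
  by move=> xX; rewrite -cardE (leq_trans _ XY) // cardE index_mem mem_enum.
exists (fun x => nth b (enum Y) (index x (enum X))); split.
  by move=> x /lt xX; rewrite -mem_enum mem_nth.
move=> x y xX yX /eqP; rewrite nth_uniq ?lt ?enum_uniq // => /eqP.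
by move/(congr1 (nth x (enum X))); rewrite !nth_index ?mem_enum.
Qed.

Definition proper_coloring (T : sgraph) (c : T -> bool) : Prop :=
  forall u v, adj u v -> c u != c v.

Lemma is_tree_coloring (T : sgraph) : is_tree T -> exists c : T -> bool,
  [/\ proper_coloring c, #|[set v | c v]| <= #|T|./2
    & \sum_(u | c u) #|nbhd u| = #|T|.-1].
Proof.
move=> tT; have [s [os sT ss]] := tree_order_full tT.
suff [c cP cs] : exists2 c : T -> bool, proper_coloring c & #|[set v | c v]| <= #|T|./2.
  exists c; split=> //.
  rewrite -ss -(@tree_order_degree_sum T c s os); last by move=> u v _ _; apply: cP.
  have us := tree_order_uniq os.
  rewrite (perm_big s) /=; last first.
    by apply: uniq_perm => //; [exact: index_enum_uniq | move=> x; rewrite sT mem_index_enum].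
  apply: eq_bigr => u _; rewrite -size_filter -(card_uniqP (filter_uniq (adj u) us)).
  by apply: eq_card => v; rewrite mem_filter sT inE andbT.
have [c cP] := tree_order_coloring os.
have {}cP : proper_coloring c by move=> u v; apply: cP; rewrite sT.
have E : #|[set v | c v]| + #|[set v | ~~ c v]| = #|T|.
  by rewrite -(cardsC [set v | c v]); congr (_ + _); apply: eq_card => v; rewrite !inE.
case: (leqP #|[set v | c v]| #|T|./2) => le; first by exists c.
exists (fun v => ~~ c v); last by lia.
by move=> u v /cP; case: (c u); case: (c v).
Qed.

Section Embeddings.
Variables (G T : sgraph) (c : T -> bool).
Hypothesis cP : proper_coloring c.

(** [Y] and its common neighbourhood are disjoint and completely joined, so any injections of the
    two colour classes into them respect the edges. *)
Lemma contains_complete_bipartite (Y : {set G}) :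
  #|[set v | c v]| <= #|Y| -> #|T| <= #|common_nbhd Y| -> contains G T.
Proof.
move=> cY TC; have [T0|/card_gt0P[x0 _]] := posnP #|T|.
  have T_empty (x : T) : False by have := max_card (pred1 x); rewrite T0 card1.
  by exists (fun x => False_rect G (T_empty x)) => x; case: (T_empty x).
have [g0 _] : exists g : G, g \in common_nbhd Y.
  by apply/card_gt0P/(leq_trans _ TC)/card_gt0P; exists x0.
have [f [fY fi]] := exists_injection g0 cY.
have [|h [hC hi]] := exists_injection g0 (X := [set v | ~~ c v]) (Y := common_nbhd Y).
  exact: leq_trans (max_card _) TC.
have fY' x : c x -> f x \in Y by move=> cx; apply: fY; rewrite inE.
have hC' x : ~~ c x -> h x \in common_nbhd Y by move=> cx; apply: hC; rewrite inE.
exists (fun x => if c x then f x else h x).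
  move=> x y; case: (boolP (c x)) => cx; case: (boolP (c y)) => cy E.
  - by apply: fi E; rewrite inE.
  - by have := common_nbhd_disjoint (hC' _ cy); rewrite -E fY'.
  - by have := common_nbhd_disjoint (hC' _ cx); rewrite E fY'.
  - by apply: hi E; rewrite inE.
move=> x y /cP; case: (boolP (c x)) => cx; case: (boolP (c y)) => cy //= _.
  exact: common_nbhd_adj (fY' _ cx) (hC' _ cy).
by rewrite adj_sym; apply: common_nbhd_adj (fY' _ cy) (hC' _ cx).
Qed.

(** When the class has one vertex too many for [Y], the leaf [p] moves to the other side: the edge
    from [p] to [q] goes to the edge from [u] to [v], and [p] has no other neighbour to respect. The
    two extra vertices of the common neighbourhood make room for [u] and [v]. *)
Lemma contains_complete_bipartite_edge (Y : {set G}) u v p q :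
  #|[set v | c v]| <= #|Y|.+1 -> #|T|.+2 <= #|common_nbhd Y| ->
  u \in common_nbhd Y -> v \in common_nbhd Y -> adj u v ->
  c p -> nbhd p = [set q] -> contains G T.
Proof.
move=> cY TC uC vC uv cp pq.
have cq : ~~ c q.
  have /cP : adj p q by rewrite -in_nbhd pq inE.
  by rewrite cp; case: (c q).
have [|f [fY fi]] := exists_injection u (X := [set v | c v] :\ p) (Y := Y).
  by move: cY; rewrite (cardsD1 p) inE cp.
have [|h [hC hi]] := exists_injection u (X := [set v | ~~ c v]) 
    (Y := common_nbhd Y :\: [set u; v]).
  apply: leq_trans (max_card _) _.
  have := cardsID [set u; v] (common_nbhd Y).
  have := subset_leq_card (subsetIr (common_nbhd Y) [set u; v]).
  have arith (a b d e : nat) : a <= 2 -> a + b = d -> e.+2 <= d -> e <= b by lia.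
  rewrite cards2 => le E; apply: arith E TC; apply: leq_trans le _; exact: leq_b1.
have fY' x : c x -> x != p -> f x \in Y by move=> cx xp; apply: fY; rewrite !inE xp.
have hC' x : ~~ c x -> [/\ h x \in common_nbhd Y, h x != u & h x != v].
  move=> cx; have : h x \in common_nbhd Y :\: [set u; v] by apply: hC; rewrite inE.
  by rewrite in_setD !inE negb_or => /andP[/andP[]].
have uv' : u != v by apply: contraTneq uv => ->; rewrite adj_irrefl.
pose F x := if x == p then u else if x == q then v else if c x then f x else h x.
have Fp : F p = u by rewrite /F eqxx.
have Fq : F q = v.
  by rewrite /F eqxx; case: eqP => // qp; rewrite qp cp in cq.
have Fc x : c x -> x != p -> F x \in Y.
  move=> cx xp; rewrite /F (negPf xp) cx; case: eqP => [E|_]; last exact: fY'.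
  by rewrite E (negPf cq) in cx.
have Fn x : ~~ c x -> F x \in common_nbhd Y /\ F x != u.
  move=> cx; rewrite /F (negPf cx); case: eqP => [E|_]; first by rewrite E cp in cx.
  by case: eqP => _; [rewrite eq_sym | have [] := hC' x cx].
exists F.
  have key x y : F x = F y -> c x -> x = y.
    move=> E cx; have [xp|xp] := eqVneq x p.
      subst x; rewrite Fp in E; have [//|yp] := eqVneq y p.
      case: (boolP (c y)) => cy.
        by have := common_nbhd_disjoint uC; rewrite E Fc.
      by have [_] := Fn _ cy; rewrite -E eqxx.
    have xY := Fc _ cx xp.
    case: (boolP (c y)) => cy; last first.
      by have [/common_nbhd_disjoint] := Fn _ cy; rewrite -E xY.
    have [yp|yp] := eqVneq y p.
      by subst y; have := common_nbhd_disjoint uC; rewrite -Fp -E xY.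
    have nq z : c z -> (z == q) = false by apply: contraTF => /eqP->.
    apply: fi; rewrite ?inE ?xp ?yp //.
    by move: E; rewrite /F (negPf xp) (negPf yp) !nq // cx cy.
  move=> x y E; case: (boolP (c x)) => cx; first exact: key.
  case: (boolP (c y)) => cy; first by apply/esym/key.
  have np z : ~~ c z -> (z == p) = false by apply: contraNF => /eqP->.
  move: E; rewrite /F !np // (negPf cx) (negPf cy).
  case: (x =P q) => [->|_]; case: (y =P q) => [->|_] // E.
  - by have [_ _] := hC' _ cy; rewrite -E eqxx.
  - by have [_ _] := hC' _ cx; rewrite E eqxx.
  - by apply: hi E; rewrite inE.
have key x y : adj x y -> c x -> adj (F x) (F y).
  move=> xy cx; have cy : ~~ c y by have := cP xy; rewrite cx; case: (c y).
  have [xp|xp] := eqVneq x p.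
    have : y \in nbhd p by rewrite -xp in_nbhd.
    by rewrite pq xp Fp inE => /eqP->; rewrite Fq.
  by apply: common_nbhd_adj (Fc _ cx xp) _; have [] := Fn _ cy.
move=> x y xy; case: (boolP (c x)) => cx; first exact: key.
by rewrite adj_sym key 1?adj_sym //; have := cP xy; rewrite (negPf cx); case: (c y).
Qed.

End Embeddings.

(** [dist] returns [#|T|] when its search fails; [d < #|T|] excludes that value, so a walk was
    found. *)
Lemma diameter_walk (T : sgraph) d (x y : T) : diameter T <= d -> d < #|T| ->
  exists p, [/\ path adj x p, last x p = y & size p <= d].
Proof.
move=> dT lt; have le : dist x y <= d.
  apply: leq_trans dT; rewrite /diameter.
  exact: leq_trans (leq_bigmax (F := fun z => dist x z) y)
                   (leq_bigmax (F := fun u => \max_(z : T) dist u z) x).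
have fnd : has (has_walk x y) (iota 0 #|T|).
  by rewrite has_find size_iota (leq_ltn_trans le lt).
have := nth_find 0 fnd; rewrite nth_iota ?add0n; last by rewrite (leq_ltn_trans le lt).
move=> /existsP[p /andP[px /eqP py]]; exists p; split=> //.
by rewrite size_tuple.
Qed.

(** * The exceptional tree: a subdivided star *)

Section Spider.
Variables (T : sgraph) (k : nat) (c : T -> bool).
Hypotheses (cP : proper_coloring c) (Tacyc : acyclic T).
Hypotheses (k_gt0 : 0 < k) (cardT : #|T| = 2 * k + 3) (diamT : diameter T <= 4).
Hypotheses (cardP : #|[set v | c v]| = k.+1).
Hypothesis degP : forall p, c p -> #|nbhd p| = 2.

(* Since every vertex of colour [c] has exactly two neighbours, [T] is the
   subdivision of the graph [linked] on the other colour class. *)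
Let linked (x y : T) := [exists p, adj p x && adj p y].

Let cC x y : adj x y -> c y = ~~ c x.
Proof. by move/cP; case: (c x); case: (c y). Qed.

Let third p x y z : c p -> adj p x -> adj p y -> x != y -> adj p z -> z = x \/ z = y.
Proof.
move=> cp px py xy pz; have : z \in [set x; y].
  suff -> : [set x; y] = nbhd p by rewrite in_nbhd.
  apply/eqP; rewrite eqEcard cards2 xy degP // andbT.
  by apply/subsetP => w; rewrite !inE => /orP[]/eqP->.
by rewrite !inE => /orP[]/eqP->; [left|right].
Qed.

(** [x] and [y] exhaust the neighbours of [p], leaving no room for [z]. This separates the midpoints
    in the cycles below. *)
Let neq_mid p q x y z : c p -> adj p x -> adj p y -> adj q z -> x != y ->
  z != x -> z != y -> p != q.
Proof.
move=> cp px py qz xy zx zy; apply/eqP => pq; subst q.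
by case: (third cp px py xy qz) => E; move: zx zy; rewrite E eqxx.
Qed.

Let neqPQ p x : c p -> ~~ c x -> p != x.
Proof. by move=> cp; apply: contraNneq => <-. Qed.

Let neqQP p x : c p -> ~~ c x -> x != p.
Proof. by move=> cp cx; rewrite eq_sym neqPQ. Qed.

Let linked_sym x y : linked x y = linked y x.
Proof. by apply: eq_existsb => p; rewrite andbC. Qed.

Let linkedP x y : ~~ c x -> linked x y -> exists p, [/\ c p, adj p x & adj p y].
Proof.
by move=> cx /existsP[p /andP[px py]]; exists p; split=> //; move: cx; rewrite (cC px) negbK.
Qed.

(** A triangle of [linked] expands, through its midpoints, into a cycle of length six in [T]; [no4]
    and [no5] likewise rest on cycles of length eight and ten. *)
Let no3 x y z : ~~ c x -> ~~ c y -> ~~ c z -> x != y -> y != z -> x != z ->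
  linked x y -> linked y z -> linked z x -> False.
Proof.
move=> cx cy cz xy yz xz.
move=> /(linkedP cx)[p [cp px py]] /(linkedP cy)[q [cq qy qz]] /(linkedP cz)[r [cr rz rx]].
have pq : p != q by apply: (neq_mid cp px py qz); rewrite // eq_sym.
have pr : p != r by apply: (neq_mid cp px py rz); rewrite // eq_sym.
have qr : q != r by apply: (neq_mid cq qy qz rx).
suff : ucycle adj [:: x; p; y; q; z; r] by move/Tacyc.
rewrite /ucycle /cycle /= (adj_sym x) px py (adj_sym y) qy qz (adj_sym z) rz rx /=.
rewrite !inE !negb_or xy yz xz pq pr qr.
by repeat (apply/andP; split); first [exact: neqPQ | exact: neqQP | done].
Qed.

Let no4 x y z w : ~~ c x -> ~~ c y -> ~~ c z -> ~~ c w ->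
  x != y -> x != z -> x != w -> y != z -> y != w -> z != w ->
  linked x y -> linked y z -> linked z w -> linked w x -> False.
Proof.
move=> cx cy cz cw xy xz xw yz yw zw.
move=> /(linkedP cx)[p [cp px py]] /(linkedP cy)[q [cq qy qz]].
move=> /(linkedP cz)[r [cr rz rw]] /(linkedP cw)[s [cs sw sx]].
have pq : p != q by apply: (neq_mid cp px py qz); rewrite // eq_sym.
have pr : p != r by apply: (neq_mid cp px py rz); rewrite // eq_sym.
have ps : p != s by apply: (neq_mid cp px py sw); rewrite // eq_sym.
have qr : q != r by apply: (neq_mid cq qy qz rw); rewrite // eq_sym.
have qs : q != s by apply: (neq_mid cq qy qz sx).
have rs : r != s by apply: (neq_mid cr rz rw sx).
suff : ucycle adj [:: x; p; y; q; z; r; w; s] by move/Tacyc.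
rewrite /ucycle /cycle /= (adj_sym x) px py (adj_sym y) qy qz (adj_sym z) rz rw.
rewrite (adj_sym w) sw sx /=.
rewrite !inE !negb_or xy xz xw yz yw zw pq pr ps qr qs rs.
by repeat (apply/andP; split); first [exact: neqPQ | exact: neqQP | done].
Qed.

Let no5 x y z w u : ~~ c x -> ~~ c y -> ~~ c z -> ~~ c w -> ~~ c u ->
  x != y -> x != z -> x != w -> x != u -> y != z -> y != w -> y != u ->
  z != w -> z != u -> w != u ->
  linked x y -> linked y z -> linked z w -> linked w u -> linked u x -> False.
Proof.
move=> cx cy cz cw cu xy xz xw xu yz yw yu zw zu wu.
move=> /(linkedP cx)[p [cp px py]] /(linkedP cy)[q [cq qy qz]].
move=> /(linkedP cz)[r [cr rz rw]] /(linkedP cw)[s [cs sw su]].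
move=> /(linkedP cu)[t [ct tu tx]].
have pq : p != q by apply: (neq_mid cp px py qz); rewrite // eq_sym.
have pr : p != r by apply: (neq_mid cp px py rz); rewrite // eq_sym.
have ps : p != s by apply: (neq_mid cp px py sw); rewrite // eq_sym.
have pt : p != t by apply: (neq_mid cp px py tu); rewrite // eq_sym.
have qr : q != r by apply: (neq_mid cq qy qz rw); rewrite // eq_sym.
have qs : q != s by apply: (neq_mid cq qy qz sw); rewrite // eq_sym.
have qt : q != t by apply: (neq_mid cq qy qz tx).
have rs : r != s by apply: (neq_mid cr rz rw su); rewrite // eq_sym.
have rt : r != t by apply: (neq_mid cr rz rw tx).
have st : s != t by apply: (neq_mid cs sw su tx).
suff : ucycle adj [:: x; p; y; q; z; r; w; s; u; t] by move/Tacyc.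
rewrite /ucycle /cycle /= (adj_sym x) px py (adj_sym y) qy qz (adj_sym z) rz rw.
rewrite (adj_sym w) sw su (adj_sym u) tu tx /=.
rewrite !inE !negb_or xy xz xw xu yz yw yu zw zu wu pq pr ps pt qr qs qt rs rt st.
by repeat (apply/andP; split); first [exact: neqPQ | exact: neqQP | done].
Qed.

(** Colours alternate along a walk, so a walk of length at most four between distinct vertices
    outside the class has length two, which is one link, or four, which is two links. *)
Let linked2 x y : ~~ c x -> ~~ c y -> x != y -> linked x y \/
  exists z, [/\ ~~ c z, z != x, z != y, linked x z & linked z y].
Proof.
move=> cx cy xy; have [/orP[->|nl]] : linked x y || ~~ linked x y by case: linked.
  by left.
right; have [|p [px py sp]] := diameter_walk x y diamT; first by rewrite cardT; lia.
case: p px py sp => [|a [|b [|d [|e [|]]]]] //=.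
- by move=> _ E; rewrite E eqxx in xy.
- by rewrite andbT => xa E; move: cy; rewrite -E (cC xa) cx.
- move=> /and3P[xa ab _] E; case/negP: nl; apply/existsP; exists a.
  by rewrite -E ab adj_sym xa.
- move=> /and4P[xa ab bd _] E; move: cy; rewrite -E (cC bd) (cC ab) (cC xa) !negbK.
  by rewrite (negPf cx).
- move=> /and5P[xa ab bd de _] E _.
  have cb : ~~ c b by rewrite (cC ab) (cC xa) negbK.
  have xb : linked x b by apply/existsP; exists a; rewrite ab adj_sym xa.
  have bY : linked b y by apply/existsP; exists d; rewrite -E de adj_sym bd.
  exists b; split=> //; [apply: contraNneq nl => <-|apply: contraNneq nl => <-] => //.
Qed.

(** A vertex [q0] with two links is the centre: a vertex [q] not linked to it but reached through
    [m] would, with another neighbour [g] of [q0], close a cycle of three, four or five links,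
    because [q] and [g] are again at most two links apart. *)
Let exists_center : exists q0, ~~ c q0 /\ forall q, ~~ c q -> q != q0 -> linked q0 q.
Proof.
have cardQ : #|[set v | ~~ c v]| = k + 2.
  have := cardsC [set v | c v]; rewrite cardT cardP.
  have -> : #|~: [set v | c v]| = #|[set v | ~~ c v]|.
    by apply: eq_card => v; rewrite !inE.
  lia.
have [x [y [z [cx cy cz [xy xz yz]]]]] : exists x y z,
    [/\ ~~ c x, ~~ c y, ~~ c z & [/\ x != y, x != z & y != z]].
  have /card_gt2P[x [y [z [[]]]]] : 2 < #|[set v | ~~ c v]| by rewrite cardQ; lia.
  rewrite !inE => cx cy cz [xy yz zx].
  by exists x, y, z; split=> //; split; rewrite // eq_sym.
have [q0 [e [f [cq0 ce cf [ef qe qf lqe lqf]]]]] : exists q0 e f,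
    [/\ ~~ c q0, ~~ c e, ~~ c f & [/\ e != f, q0 != e, q0 != f, linked q0 e & linked q0 f]].
  have [lxy|[m [cm mx my lxm lmy]]] := linked2 cx cy xy; last first.
    by exists m, x, y; split=> //; split=> //; rewrite linked_sym.
  have [lxz|[m [cm mx mz lxm lmz]]] := linked2 cx cz xz; last first.
    by exists m, x, z; split=> //; split=> //; rewrite linked_sym.
  by exists x, y, z.
exists q0; split=> // q cq qq0.
have q0q : q0 != q by rewrite eq_sym.
have [//|[m [cm mq0 mq lq0m lmq]]] := linked2 cq0 cq q0q.
apply: contraT => nl.
have [g [cg gm q0g lg]] : exists g, [/\ ~~ c g, g != m, q0 != g & linked q0 g].
  have [em|em] := eqVneq e m; last by exists e.
  by exists f; split=> //; rewrite -em eq_sym.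
have gq : g != q by apply: contraNneq nl => <-.
have qm : q != m by rewrite eq_sym.
have mg : m != g by rewrite eq_sym.
have qg : q != g by rewrite eq_sym.
have lqm : linked q m by rewrite linked_sym.
have lmq0 : linked m q0 by rewrite linked_sym.
have [lqg|[h [ch hq hg lqh lhg]]] := linked2 cq cg qg.
  by case: (no4 cq cm cq0 cg); rewrite // linked_sym.
have hq0 : h != q0 by apply: contraNneq nl => <-; rewrite linked_sym.
have [hm|hm] := eqVneq h m.
  by subst h; case: (no3 cm cq0 cg); rewrite // linked_sym.
by case: (no5 cq cm cq0 cg ch); rewrite // 1?linked_sym // eq_sym.
Qed.

Lemma isomorphic_spider2 : isomorphic T (spider2 k).
Proof.
have [q0 [cq0 q0P]] := exists_center.
have midP q : exists p, ~~ c q -> q != q0 -> [/\ c p, adj p q0 & adj p q].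
  case: (boolP (~~ c q && (q != q0))) => [/andP[cq qq0]|nq].
    by have [p pP] := linkedP cq0 (q0P _ cq qq0); exists p.
  by exists q => cq qq0; rewrite cq qq0 in nq.
have [m mP] := choice midP.
pose Q := [set v | ~~ c v] :\ q0.
have inQ q : (q \in Q) = (q != q0) && ~~ c q by rewrite !inE.
have mi : {in Q &, injective m}.
  move=> x y; rewrite !inQ => /andP[xq cx] /andP[yq cy] E.
  have [cm mq mx] := mP _ cx xq; have [_ _ my] := mP _ cy yq.
  rewrite -E in my; rewrite eq_sym in xq.
  by case: (third cm mq mx xq my) => // yE; rewrite yE eqxx in yq.
(* [Q] and the class [c] both have [k.+1] elements, so the injective [m] is onto, and every vertex
   of the class lies between [q0] and a vertex of [Q]. *)
have imm : m @: Q = [set v | c v].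
  apply/eqP; rewrite eqEcard (card_in_imset mi) cardP; apply/andP; split.
    by apply/subsetP => p /imsetP[q]; rewrite inQ => /andP[qq cq] ->; rewrite inE; case: (mP q).
  have := cardsC [set v | c v]; rewrite cardT cardP.
  have -> : #|~: [set v | c v]| = #|Q|.+1.
    rewrite (cardsD1 q0) !inE cq0 add1n; congr _.+1.
    by apply: eq_card => v; rewrite !inE.
  lia.
have cq0p p : c p -> adj p q0.
  move=> cp; have : p \in m @: Q by rewrite imm inE.
  by case/imsetP => q; rewrite inQ => /andP[qq cq] ->; case: (mP q).
have adj_mid p q : c p -> q \in Q -> adj p q = (m q == p).
  rewrite inQ => cp /andP[qq cq]; have [cm mq0 mq] := mP _ cq qq.
  apply/idP/eqP => [pq|<-//].
  have : p \in m @: Q by rewrite imm inE.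
  case/imsetP => r rQ E; rewrite E in pq *.
  move: (rQ); rewrite inQ => /andP[rq cr]; have [cmr mrq mr] := mP _ cr rq.
  have q0r : q0 != r by rewrite eq_sym.
  by case: (third cmr mrq mr q0r pq) => [qE|->//]; rewrite qE eqxx in qq.
have [g [_ gi]] : exists g : T -> 'I_k.+1,
    {in [set v | c v], forall x, g x \in [set: 'I_k.+1]} /\ {in [set v | c v] &, injective g}.
  by apply: (exists_injection ord0); rewrite cardP cardsT card_ord.
pose leg i : {set star k.+1} := [set inl ord0; inr i].
have legP i : leg i \in edge_set (star k.+1).
  by apply/imsetP; exists (inl ord0, inr i); rewrite ?inE.
(* The centre goes to the centre of the star, a vertex of colour [c] to the vertex subdividing its
   leg, and an outer vertex to the leaf on the leg of its midpoint. *)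
pose F x : spider2 k := if x == q0 then inl (inl ord0) else
  if c x then inr (exist _ (leg (g x)) (legP (g x))) else inl (inr (g (m x))).
have leg_mem i j : (inr i \in leg j) = (i == j) by rewrite !inE.
have leg_inj i j : leg i = leg j -> i = j.
  by move=> E; apply/eqP; rewrite -leg_mem -E leg_mem.
have split x : [\/ x = q0, x != q0 /\ c x | x \in Q].
  rewrite inQ; have [->|xq] := eqVneq x q0; first by constructor 1.
  by case: (boolP (c x)) => cx; [constructor 2|constructor 3].
have F0 : F q0 = inl (inl ord0) by rewrite /F eqxx.
have Fc x : c x -> F x = inr (exist _ (leg (g x)) (legP (g x))).
  by move=> cx; rewrite /F cx; case: eqP => // E; rewrite -E cx in cq0.
have FQ x : x \in Q -> F x = inl (inr (g (m x))).
  by rewrite inQ /F => /andP[/negPf-> /negPf->].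
have mc x : x \in Q -> c (m x).
  by rewrite inQ => /andP[qq cq]; case: (mP x).
have Q0 x : x \in Q -> x != q0 /\ ~~ c x by rewrite inQ => /andP[].
exists F; last first.
  move=> x y; case: (split x) => [->|[xq cx]|xQ]; case: (split y) => [->|[yq cy]|yQ].
  - by rewrite F0 !adj_irrefl.
  - by rewrite (adj_sym q0) cq0p // F0 (Fc _ cy) /= !inE.
  - rewrite F0 (FQ _ yQ) /=; apply/esym/negP => /cC; have [_ /negPf->] := Q0 _ yQ.
    by rewrite (negPf cq0).
  - by rewrite F0 (Fc _ cx) cq0p //= !inE.
  - by rewrite !Fc //=; apply/esym/negP => /cC; rewrite cx cy.
  - rewrite (Fc _ cx) (FQ _ yQ) adj_mid //= leg_mem.
    apply/eqP/eqP => [|-> //]; apply: gi; rewrite inE //; exact: mc.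
  - rewrite F0 (FQ _ xQ) /=; apply/esym/negP => /cC; have [_ /negPf->] := Q0 _ xQ.
    by rewrite (negPf cq0).
  - rewrite (adj_sym x) adj_mid // (Fc _ cy) (FQ _ xQ) //= leg_mem.
    apply/eqP/eqP => [|-> //]; apply: gi; rewrite inE //; exact: mc.
  - rewrite !FQ //=; apply/esym/negP => /cC; have [_ /negPf->] := Q0 _ xQ.
    by have [_ /negPf->] := Q0 _ yQ.
apply: inj_card_bij.
  move=> x y; case: (split x) => [->|[xq cx]|xQ]; case: (split y) => [->|[yq cy]|yQ] //.
  - by rewrite F0 (Fc _ cy).
  - by rewrite F0 (FQ _ yQ).
  - by rewrite F0 (Fc _ cx).
  - by rewrite !Fc // => -[/leg_inj]; apply: gi; rewrite inE.
  - by rewrite (Fc _ cx) (FQ _ yQ).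
  - by rewrite F0 (FQ _ xQ).
  - by rewrite (Fc _ cy) (FQ _ xQ).
  - rewrite !FQ // => -[/gi E]; apply: mi => //; apply: E; rewrite inE; exact: mc.
(* Since [F] is injective, it remains to bound the order of the target by [#|T|], that is, the
   number of edges of the star by [k.+1]. *)
rewrite cardT card_sum card_sum !card_ord card_sig.
have : #|edge_set (star k.+1)| <= k.+1.
  rewrite -[k.+1 in leqRHS]card_ord -cardsT.
  apply: leq_trans (leq_imset_card leg [set: 'I_k.+1]); apply/subset_leq_card/subsetP.
  move=> e /imsetP[[[a|a] [b|b]]]; rewrite ?inE //= => ab ->; apply/imsetP.
  - by rewrite !ord1 in ab.
  - by exists b; rewrite ?in_setT //=; congr (_ :|: _); congr [set (inl _)]; apply: ord1.
  - by exists a; rewrite ?in_setT //= setUC; congr (_ :|: _); congr [set (inl _)]; apply: ord1.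
  - by case/andP: ab => ab /negP[].
have -> : #|[pred x | x \in edge_set (star k.+1)]| = #|edge_set (star k.+1)|.
  by apply: eq_card => x; rewrite inE.
lia.
Qed.

End Spider.

(** * Colour classes of the trees and what a [T]-free graph excludes *)

Lemma connected_nbhd_gt0 (T : sgraph) (x : T) :
  connected_graph T -> 1 < #|T| -> 0 < #|nbhd x|.
Proof.
move=> Tconn /card_gt1P[y [z [_ _ yz]]].
have [w xw] : exists w, w != x.
  have [yx|yx] := eqVneq y x; last by exists y.
  by exists z; rewrite -yx eq_sym.
have /connectP[[|a p]] := Tconn x w; first by move=> _ E; rewrite E eqxx in xw.
by move=> /andP[xa _] _; apply/card_gt0P; exists a; rewrite in_nbhd.
Qed.

(** A class of [k.+1] vertices without a leaf has degrees at least two with sum [2 * k + 2]; hence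
    all are two, and [T] is the excluded spider. *)
Lemma tree_family_coloring (k : nat) (T : sgraph) : 0 < k -> tree_family k T ->
  exists c : T -> bool, [/\ proper_coloring c, #|[set v | c v]| <= k.+1
    & #|[set v | c v]| <= k \/ exists p q, c p /\ nbhd p = [set q]].
Proof.
move=> k0 [tT cT dT nT]; have [c [cP leP sumP]] := is_tree_coloring tT.
have le : #|[set v | c v]| <= k.+1 by apply: leq_trans leP _; rewrite cT; lia.
exists c; split=> //; move: le; rewrite leq_eqVlt => /orP[/eqP cardP|]; last by left.
right; apply: contrapT => noleaf; apply: nT.
have [_ Tconn Tacyc] := tT.
have deg p : c p -> 2 <= #|nbhd p|.
  move=> cp; have : 0 < #|nbhd p| by apply: connected_nbhd_gt0; rewrite // cT; lia.
  rewrite leq_eqVlt => /orP[|//]; rewrite eq_sym => /cards1P[q pq].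
  by case: noleaf; exists p, q.
apply: (isomorphic_spider2 cP) => // p cp; apply/eqP; rewrite eqn_leq deg // andbT.
have : \sum_(u | c u) 2 = \sum_(u | c u) #|nbhd u|.
  by rewrite sumP sum_nat_const cT -cardsE cardP; lia.
rewrite (bigD1 p) //= [RHS](bigD1 p) //= => E.
have : \sum_(u | c u && (u != p)) 2 <= \sum_(u | c u && (u != p)) #|nbhd u|.
  by apply: leq_sum => u /andP[/deg].
by move: E; clear; lia.
Qed.

Section TreeFree.
Variables (k : nat) (G T : sgraph).
Hypotheses (k_gt0 : 0 < k) (TF : tree_family k T) (GT : ~ contains G T).

Lemma tree_free_complete_bipartite (Y : {set G}) :
  #|Y| = k.+1 -> #|common_nbhd Y| < 2 * k + 3.
Proof.
move=> cY; rewrite ltnNge; apply/negP => le; apply: GT.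
have [c [cP leP _]] := tree_family_coloring k_gt0 TF.
apply: (contains_complete_bipartite cP (Y := Y)); first by rewrite cY.
by case: TF => _ -> _ _.
Qed.

(** [2 * k + 5] is [#|T|] plus the two ends of a supposed edge in the common neighbourhood. That
    edge would host the leaf edge of [T] when the class has [k.+1] vertices; a smaller class fits
    into [L] directly. *)
Lemma tree_free_independent (L : {set G}) : #|L| = k -> 2 * k + 5 <= #|common_nbhd L| ->
  {in common_nbhd L &, forall u v, ~~ adj u v}.
Proof.
move=> cL le u v uC vC; apply/negP => uv; apply: GT.
have [_ cT _ _] := TF.
have [c [cP leP [leP'|[p [q [cp pq]]]]]] := tree_family_coloring k_gt0 TF.
  by apply: (contains_complete_bipartite cP (Y := L)); rewrite ?cL // cT; lia.
by apply: (contains_complete_bipartite_edge cP (Y := L) _ _ uC vC uv cp pq);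
  rewrite ?cL // cT; lia.
Qed.

End TreeFree.

Lemma isomorphic_S_graph (G : sgraph) (L : {set G}) n k :
  0 < k -> #|G| = n -> #|L| = k ->
  (forall x y : G, adj x y = (x != y) && ((x \in L) || (y \in L))) ->
  isomorphic G (S_graph n k).
Proof.
move=> k_gt0 cG cL adjE; have kn : k <= n by rewrite -cL -cG max_card.
pose left_part : {set S_graph n k} := [set inl i | i : 'I_k].
pose right_part : {set S_graph n k} := [set inr i | i : 'I_(n - k)].
have cleft : #|left_part| = k by rewrite card_imset ?card_ord // => i j [].
have cright : #|right_part| = n - k by rewrite card_imset ?card_ord // => i j [].
have cLC : #|~: L| = n - k by rewrite -cG -(cardsC L) cL addKn.
pose v0 : S_graph n k := inl (Ordinal k_gt0).
have [g [gY gi]] : exists g : G -> S_graph n k,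
    {in L, forall x, g x \in left_part} /\ {in L &, injective g}.
  by apply: (exists_injection v0); rewrite cleft cL.
have [h [hY hi]] : exists h : G -> S_graph n k,
    {in ~: L, forall x, h x \in right_part} /\ {in ~: L &, injective h}.
  by apply: (exists_injection v0); rewrite cright cLC.
pose F x := if x \in L then g x else h x.
have FL x : x \in L -> exists i, F x = inl i.
  by move=> xL; rewrite /F xL; case/imsetP: (gY x xL) => i _ ->; exists i.
have FR x : x \notin L -> exists i, F x = inr i.
  move=> xL; rewrite /F (negPf xL).
  have : x \in ~: L by rewrite inE.
  by case/hY/imsetP => i _ ->; exists i.
have Fi : injective F.
  move=> x y E; case: (boolP (x \in L)) => xL; case: (boolP (y \in L)) => yL.
  - by apply: gi => //; move: E; rewrite /F xL yL.
  - by have [i] := FL _ xL; have [j] := FR _ yL; rewrite E => ->.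
  - by have [i] := FL _ yL; have [j] := FR _ xL; rewrite E => ->.
  - by apply: hi; rewrite ?inE //; move: E; rewrite /F (negPf xL) (negPf yL).
exists F; first by apply: inj_card_bij => //; rewrite card_sum !card_ord cG subnKC.
move=> x y; rewrite adjE -(inj_eq Fi).
case: (boolP (x \in L)) => xL; case: (boolP (y \in L)) => yL /=.
- by have [i ->] := FL _ xL; have [j ->] := FL _ yL; rewrite andbT.
- by have [i ->] := FL _ xL; have [j ->] := FR _ yL.
- by have [i ->] := FR _ xL; have [j ->] := FL _ yL.
- have [i ->] := FR _ xL; have [j ->] := FR _ yL; rewrite andbF /= /compl_rel /=.
  by rewrite /complete_rel andbN.
Qed.

(** * Spectral radius and concentration of an eigenvector *)

Import Order.TTheory GRing.Theory Num.Theory.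
Local Open Scope ring_scope.

Section SpectralRadius.
Variable R : realType.

(** Without a maximum, each element of [E] is exceeded by another, which yields more distinct roots
    than [p] can have. It makes the supremum in [mu] attained once a real eigenvalue exists. *)
Lemma roots_max (p : {poly R}) (E : R -> Prop) : p != 0 -> (exists a, E a) ->
  (forall a, E a -> root p a) -> exists2 m, E m & forall a, E a -> a <= m.
Proof.
move=> p0 [a0 Ea0] Er; apply: contrapT => nomax.
have up a : E a -> exists2 b, E b & a < b.
  move=> Ea; apply: contrapT => nb; apply: nomax; exists a => // b Eb.
  by rewrite leNgt; apply/negP => ab; apply: nb; exists b.
suff H m : exists a s, [/\ E a, path >%R a s, size s = m & all (root p) s].
  have [a [s [_ pth sz rs]]] := H (size p).
  have us : uniq s.
    apply: (@sorted_uniq _ (>%R : rel R)) (path_sorted pth); last by move=> b; apply: ltxx.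
    by move=> b c d /= cb bd; apply: lt_trans bd cb.
  by have := max_poly_roots p0 rs us; rewrite sz ltnn.
elim: m => [|m [a [s [Ea pth sz rs]]]]; first by exists a0, [::].
have [b Eb ab] := up a Ea; exists b, (a :: s); split=> //=; rewrite ?sz //.
  by rewrite ab pth.
by rewrite Er.
Qed.

Lemma eigenvalue_max (G : sgraph) : (exists a, eigenvalue (adjmx R G) a) ->
  eigenvalue (adjmx R G) (mu R G) /\ forall a, eigenvalue (adjmx R G) a -> a <= mu R G.
Proof.
move=> ex; have [||m Em mP] := @roots_max (char_poly (adjmx R G))
  (fun a => eigenvalue (adjmx R G) a) _ ex.
- by rewrite monic_neq0 // char_poly_monic.
- by move=> a; rewrite eigenvalue_root_char.
suff -> : mu R G = m by [].
apply/eqP; rewrite eq_le; apply/andP; split.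
  by apply: ge_sup => //; exists m.
by apply: ub_le_sup => //; exists m.
Qed.

(** The supremum of the empty set is 0, so a positive [mu] ensures that an eigenvalue exists. *)
Lemma eigenvalue_mu (G : sgraph) : 0 < mu R G -> eigenvalue (adjmx R G) (mu R G).
Proof.
move=> mu_gt0; apply: (eigenvalue_max _).1; apply: contrapT => none.
suff E : [set a : R | eigenvalue (adjmx R G) a]%classic = classical_sets.set0.
  by move: mu_gt0; rewrite /mu E sup0 ltxx.
by rewrite -classical_sets.subset0 => a Ea; apply: none; exists a.
Qed.

Lemma eigenvalue_le_mu (G : sgraph) a : eigenvalue (adjmx R G) a -> a <= mu R G.
Proof. by move=> Ea; apply: (eigenvalue_max _).2 => //; exists a. Qed.

(** Taking absolute values in an eigenvector turns the eigenvalue equation into an inequality, by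
    the triangle inequality; dividing by the largest entry normalises it. This takes the place of a
    Perron vector of [G]. *)
Lemma mu_subharmonic (G : sgraph) : 0 < mu R G -> exists x : G -> R,
  [/\ forall v, 0 <= x v <= 1, exists z, x z = 1
    & forall v, mu R G * x v <= \sum_(w in nbhd v) x w].
Proof.
move=> mu_gt0; have /eigenvalueP[y yA y0] := eigenvalue_mu mu_gt0.
have [j0 yj0] : exists j, y 0 j != 0.
  apply: contrapT => none; case/eqP: y0; apply/rowP => j; rewrite mxE.
  by apply/eqP; apply: contraT => yj; case: none; exists j.
pose Y v := `|y 0 (enum_rank v)|.
have YA v : mu R G * Y v <= \sum_(w in nbhd v) Y w.
  have /rowP/(_ (enum_rank v)) := yA; rewrite !mxE => E.
  rewrite /Y -{1}(gtr0_norm mu_gt0) -normrM -E.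
  apply: le_trans (ler_norm_sum _ _ _) _.
  rewrite (reindex (@enum_rank G)) /=; last by apply: onW_bij; apply: enum_rank_bij.
  rewrite [leRHS]big_mkcond /=; apply: ler_sum => w _.
  by rewrite mxE !enum_rankK in_nbhd adj_sym; case: adj; rewrite ?mulr1 ?mulr0 ?normr0.
have [z zP] : exists z, forall v, Y v <= Y z.
  pose z := [arg max_(v > enum_val j0) Y v]%O.
  by exists z => v; rewrite /z; case: arg_maxP => // i _; apply.
have Yz : 0 < Y z.
  by apply: lt_le_trans (zP (enum_val j0)); rewrite /Y enum_valK normr_gt0.
exists (fun v => Y v / Y z); split.
- by move=> v; rewrite divr_ge0 ?normr_ge0 //= ler_pdivrMr // mul1r.
- by exists z; rewrite divff // gt_eqF.
- by move=> v; rewrite -mulr_suml mulrA ler_pM2r // invr_gt0.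
Qed.

(** The eigenvector is [lam] on the clique and [k] on the independent set: at a clique vertex the
    equation is the quadratic for [lam], elsewhere both sides are [k * lam]. *)
Lemma eigenvalue_S_graph n k (lam : R) : (0 < k <= n)%N -> 0 < lam ->
  lam ^+ 2 = (k%:R - 1) * lam + k%:R * (n - k)%:R ->
  eigenvalue (adjmx R (S_graph n k)) lam.
Proof.
move=> /andP[k0 kn] lam0 E.
pose z (v : S_graph n k) : R := if v is inl _ then lam else k%:R.
have zA v : \sum_(w in nbhd v) z w = lam * z v.
  rewrite big_mkcond big_sumType /=.
  case: v => i /=.
    rewrite (bigD1 i) //= inE /= /complete_rel eqxx /= add0r.
    rewrite (eq_bigr (fun=> lam)); last first.
      by move=> j ji; rewrite inE /= /complete_rel eq_sym ji.
    rewrite [X in _ + X](eq_bigr (fun=> k%:R)); last by move=> j _; rewrite inE.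
    rewrite !sumr_const card_ord cardC1 card_ord -expr2 E.
    rewrite -[lam *+ _]mulr_natl -[k%:R *+ _]mulr_natl.
    by rewrite -(natrB _ k0) subn1 [(n - k)%:R * _]mulrC.
  rewrite (eq_bigr (fun=> lam)); last by move=> j _; rewrite inE.
  rewrite [X in _ + X]big1 ?addr0; last first.
    by move=> j _; rewrite inE /= /compl_rel /= /complete_rel andbN.
  by rewrite sumr_const card_ord mulr_natr.
apply/eigenvalueP; exists (\row_j z (enum_val j)).
  apply/rowP => j; rewrite !mxE -zA [RHS]big_mkcond /=.
  rewrite (reindex (@enum_rank (S_graph n k))) /=; last first.
    by apply: onW_bij; apply: enum_rank_bij.
  apply: eq_bigr => w _; rewrite !mxE !enum_rankK inE adj_sym.
  by case: adj; rewrite ?mulr1 ?mulr0.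
apply/eqP => /rowP/(_ (enum_rank (inl (Ordinal k0) : S_graph n k))).
by rewrite !mxE enum_rankK /z => /eqP; rewrite gt_eqF.
Qed.

End SpectralRadius.

(** * Comparison with the Perron vector of [S_graph] *)

Lemma exchange_adj (V : nmodType) (G : sgraph) (A B : {set G}) (F : G -> G -> V) :
  \sum_(v in A) \sum_(w in nbhd v :&: B) F v w =
  \sum_(w in B) \sum_(v in nbhd w :&: A) F v w.
Proof.
rewrite (exchange_big_dep (mem B)) /=; last by move=> v w _; rewrite inE => /andP[].
apply: eq_bigr => w wB; apply: eq_bigl => v.
by rewrite !inE wB andbT andbC adj_sym.
Qed.

Lemma exchange_card_nbhd (G : sgraph) (A B : {set G}) :
  (\sum_(v in A) #|nbhd v :&: B| = \sum_(w in B) #|nbhd w :&: A|)%N.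
Proof.
under eq_bigr do rewrite -sum1_card; under [RHS]eq_bigr do rewrite -sum1_card.
exact: (exchange_adj A B (fun _ _ => 1%N)).
Qed.

Section Endgame.
Variables (R : realType) (G : sgraph) (k t : nat) (lam lam0 gamma : R) (x : G -> R).
Variable L : {set G}.
Let W := common_nbhd L.
Let B := ~: (L :|: W).
Hypotheses (k_gt0 : (0 < k)%N) (cardL : #|L| = k).
Hypotheses (x_ge0 : forall v, 0 <= x v) (gamma_ge0 : 0 <= gamma).
Hypothesis x_sub : forall v, lam * x v <= \sum_(w in nbhd v) x w.
Hypotheses (lam0_gt0 : 0 < lam0) (lam_ge : lam0 <= lam) (lam0_ge : (k * t)%:R <= lam0).
Hypothesis lam0E : lam0 ^+ 2 = (k%:R - 1) * lam0 + k%:R * (#|G| - k)%:R.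
Hypotheses (xL : {in L, forall v, 2^-1 <= x v}) (xLC : {in ~: L, forall v, x v <= gamma}).
Hypothesis gamma_lt : 6 * t%:R * gamma < 1.
Hypothesis sparse : forall U : {set G}, (\sum_(u in U) #|nbhd u :&: U| <= 2 * t * #|U|)%N.
Hypothesis W_indep : {in W &, forall u v, ~~ adj u v}.
Hypothesis nbhd_W : {in ~: L, forall v, #|nbhd v :&: W| <= t}%N.

Let miss w := #|~: L :\: nbhd w|.

(* [lam0] on [L] and [k] off [L] is the Perron vector of [S_(n, k)] when [L] is
   its clique, so [excess] measures by how much [G] beats [S_(n, k)] locally. *)
Let excess w : R := lam0 * #|nbhd w :&: L|%:R + k%:R * #|nbhd w :\: L|%:R
  - lam0 * (if w \in L then lam0 else k%:R).

(** By symmetry of the adjacency matrix [A], the sum is the pairing of the nonnegative vector [z]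
    with [A x - lam0 x], which is nonnegative because [lam0 <= lam]. *)
Let sum_excess : 0 <= \sum_w x w * excess w.
Proof.
pose z v : R := if v \in L then lam0 else k%:R.
have zN w : \sum_(v in nbhd w) z v = lam0 * #|nbhd w :&: L|%:R + k%:R * #|nbhd w :\: L|%:R.
  rewrite (big_setID L) /=; congr (_ + _).
    rewrite (eq_bigr (fun=> lam0)) ?sumr_const ?mulr_natr //.
    by move=> v; rewrite inE /z => /andP[_ ->].
  rewrite (eq_bigr (fun=> k%:R)) ?sumr_const ?mulr_natr //.
  by move=> v; rewrite inE /z => /andP[/negPf->].
have z_ge0 v : 0 <= z v by rewrite /z; case: ifP => _; rewrite ?ler0n // ltW.
have E : \sum_v z v * \sum_(w in nbhd v) x w = \sum_w x w * \sum_(v in nbhd w) z v.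
  transitivity (\sum_(v in [set: G]) \sum_(w in nbhd v :&: [set: G]) z v * x w).
    apply: eq_big => [v|v _]; first by rewrite inE.
    by rewrite mulr_sumr setIT.
  rewrite exchange_adj; apply: eq_big => [v|v _]; first by rewrite inE.
  by rewrite mulr_sumr setIT; apply: eq_bigr => w _; rewrite mulrC.
have -> : \sum_w x w * excess w = \sum_v z v * \sum_(w in nbhd v) x w - \sum_v z v * (lam0 * x v).
  rewrite E -sumrB; apply: eq_bigr => w _; rewrite zN /excess -/(z w); ring.
rewrite subr_ge0; apply: ler_sum => v _; apply: ler_wpM2l => //.
by apply: le_trans (x_sub v); apply: ler_wpM2r.
Qed.

Let card_nbhd_L w : w \in L -> (#|nbhd w :&: L| <= k.-1)%N.
Proof.
move=> wL; rewrite -cardL (cardsD1 w L) wL; apply/subset_leq_card/subsetP => v.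
by rewrite !inE => /andP[wv ->]; rewrite andbT; apply: contraTneq wv => ->; rewrite adj_irrefl.
Qed.

(** The quadratic equation makes [lam0 ^+ 2] the weight of a full neighbourhood, so only losses
    remain: a missing neighbour in [L] costs [lam0], one outside costs [k]. *)
Let excess_L w : w \in L ->
  excess w = - (lam0 * (k.-1 - #|nbhd w :&: L|)%:R) - k%:R * (miss w)%:R.
Proof.
move=> wL; have le := card_nbhd_L wL.
rewrite /excess wL -expr2 lam0E (natrB _ le) -subn1 (natrB _ k_gt0).
have -> : (#|G| - k = #|nbhd w :\: L| + miss w)%N.
  rewrite -cardL -(cardsC L) addKn -(cardsID (nbhd w) (~: L)); congr (_ + _)%N.
  by apply: eq_card => v; rewrite !inE.
rewrite natrD; ring.
Qed.

Let B_W_L v : v \notin L -> (v \in B) = (v \notin W).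
Proof. by move=> vL; rewrite /B in_setC in_setU (negPf vL). Qed.

(** A vertex of [W] is joined to all of [L] and to nothing in [W], so everything but [B] cancels.
    Any other vertex misses part of [L] and loses at least [lam0], which is at least [k * t] and
    pays for its at most [t] neighbours in [W]. *)
Let excess_LC w : w \notin L -> excess w <= k%:R * #|nbhd w :&: B|%:R.
Proof.
move=> wL; rewrite /excess (negPf wL).
have NL : #|nbhd w :\: L| = (#|nbhd w :&: W| + #|nbhd w :&: B|)%N.
  rewrite -(cardsID W (nbhd w :\: L)); congr (_ + _)%N; apply: eq_card => v.
    rewrite !in_setI in_setD; case: (boolP (v \in W)) => vW; rewrite ?andbF // !andbT.
    by rewrite (common_nbhd_disjoint vW).
  by rewrite in_setD in_setD in_setI /B in_setC in_setU negb_or; case: (v \in W); case: (v \in L);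
     rewrite ?andbF ?andbT.
case: (boolP (w \in W)) => wW.
  have -> : nbhd w :&: L = L.
    by apply/setIidPr; move: wW; rewrite inE.
  rewrite cardL NL; have -> : #|nbhd w :&: W| = 0%N.
    apply/eqP; rewrite cards_eq0; apply/eqP/setP => v; rewrite in_setI in_set0 in_nbhd.
    by apply/negP => /andP[wv vW]; have := W_indep wW vW; rewrite wv.
  by rewrite add0n addrAC subrr add0r.
have lt : (#|nbhd w :&: L| <= k.-1)%N.
  suff : (#|nbhd w :&: L| < k)%N by lia.
  rewrite -cardL; apply/proper_card; rewrite properE subsetIr /=.
  apply: contra wW => /subsetP sub; rewrite inE; apply/subsetP => v vL.
  by have := sub v vL; rewrite inE => /andP[].
have le : (#|nbhd w :&: W| <= t)%N by apply: nbhd_W; rewrite inE.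
rewrite NL natrD.
have h1 : #|nbhd w :&: L|%:R <= k%:R - 1 :> R by rewrite lerBrDr natr1 ler_nat -(prednK k_gt0) ltnS.
have h2 : #|nbhd w :&: W|%:R <= t%:R :> R by rewrite ler_nat.
have h3 : lam0 * #|nbhd w :&: L|%:R <= lam0 * (k%:R - 1) by rewrite ler_pM2l.
have h4 : k%:R * #|nbhd w :&: W|%:R <= k%:R * t%:R :> R by rewrite ler_wpM2l.
move: lam0_ge; rewrite natrM => h5; lra.
Qed.

(** The degrees into [B] sum to at most [3 * t * #|B|]: [t] per vertex of [B] for the edges to [W],
    and [2 * t] for those inside [B] by sparsity. *)
Let sum_excess_LC : \sum_(w in ~: L) x w * excess w <= 3 * t%:R * gamma * (k * #|B|)%:R.
Proof.
apply: (@le_trans _ _ (\sum_(w in ~: L) gamma * (k%:R * #|nbhd w :&: B|%:R))).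
  apply: ler_sum => w wL; have wL' : w \notin L by rewrite inE in wL.
  apply: (@le_trans _ _ (x w * (k%:R * #|nbhd w :&: B|%:R))).
    by apply: ler_wpM2l => //; apply: excess_LC.
  by apply: ler_wpM2r; [rewrite mulr_ge0 | apply: xLC].
rewrite -mulr_sumr -mulr_sumr -natr_sum.
have : (\sum_(w in ~: L) #|nbhd w :&: B| <= 3 * t * #|B|)%N.
  rewrite (big_setID W) /=.
  have h1 : (\sum_(w in ~: L :&: W) #|nbhd w :&: B| <= t * #|B|)%N.
    rewrite exchange_card_nbhd mulnC -sum_nat_const; apply: leq_sum => v vB.
    apply: leq_trans (nbhd_W (x := v) _); last first.
      by move: vB; rewrite !inE negb_or => /andP[].
    by apply/subset_leq_card/setIS/subsetIr.
  have h2 : (\sum_(w in ~: L :\: W) #|nbhd w :&: B| <= 2 * t * #|B|)%N.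
    by have := sparse B; have -> : ~: L :\: W = B by rewrite /B setCU setDE.
  by apply: leq_trans (leq_add h1 h2) _; rewrite -mulnDl; apply: leq_mul => //; lia.
rewrite -(ler_nat R) natrM natrM => h.
have : gamma * k%:R * (\sum_(w in ~: L) #|nbhd w :&: B|)%:R <= gamma * k%:R * (3 * t%:R * #|B|%:R).
  by apply: ler_wpM2l => //; rewrite mulr_ge0.
rewrite natrM; lra.
Qed.

Let card_B_miss : (#|B| <= \sum_(w in L) miss w)%N.
Proof.
have -> : (\sum_(w in L) miss w = \sum_(w in L) \sum_(v in ~: L) (v \notin nbhd w))%N.
  apply: eq_bigr => w _; rewrite -big_mkcondr /= sum1_card; apply: eq_card => v.
  by rewrite !inE unfold_in /= [in RHS]unfold_in /= !inE andbC.
rewrite exchange_big /= -sum1_card [leqLHS]big_mkcond [leqRHS]big_mkcond /=.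
apply: leq_sum => v _; rewrite !in_setC in_setU negb_or; case: (boolP (v \in L)) => //= vL.
case: (boolP (v \in W)) => //= vW.
have /subsetPn[w wL wv] : ~~ (L \subset nbhd v) by rewrite inE in vW.
by rewrite (bigD1 w) //= in_nbhd adj_sym -in_nbhd wv.
Qed.

Lemma extremal_structure (u v : G) : adj u v = (u != v) && ((u \in L) || (v \in L)).
Proof.
(* Entries on [L] are at least 1/2, so the losses there are at least half of [lam0 * S + k * #|B|];
   the gains off [L] are at most [3 * t * gamma * k * #|B|], where [3 * t * gamma] is below 1/2. As
   the total is nonnegative, [S] and [#|B|] vanish. *)
have key : (\sum_(w in L) (k.-1 - #|nbhd w :&: L|) = 0)%N /\ #|B| = 0%N.
  set S := (\sum_(w in L) (k.-1 - #|nbhd w :&: L|))%N.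
  have hL : \sum_(w in L) x w * excess w <= - (2^-1 * (lam0 * S%:R + (k * #|B|)%:R)).
    apply: (@le_trans _ _ (- \sum_(w in L) 2^-1 * (lam0 * (k.-1 - #|nbhd w :&: L|)%:R + k%:R * (miss w)%:R))).
      rewrite -sumrN; apply: ler_sum => w wL; rewrite excess_L //.
      set a := lam0 * _; set b := k%:R * _.
      have a0 : 0 <= a by rewrite mulr_ge0 // ltW.
      have b0 : 0 <= b by rewrite mulr_ge0.
      have := ler_wpM2r (addr_ge0 a0 b0) (xL wL); lra.
    rewrite lerN2 -mulr_sumr; apply: ler_wpM2l; first by rewrite invr_ge0.
    rewrite big_split /= -!mulr_sumr -!natr_sum lerD2l natrM.
    by apply: ler_wpM2l; rewrite ?ler_nat.
  have h0 := sum_excess; rewrite (bigID (mem L)) /= in h0.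
  have hC := sum_excess_LC.
  rewrite (eq_bigl (fun w => w \notin L)) in hC; last by move=> w; rewrite inE.
  have : lam0 * S%:R + (1 - 6 * t%:R * gamma) * (k * #|B|)%:R <= 0 by lra.
  have a0 : 0 <= lam0 * S%:R by rewrite mulr_ge0 // ltW.
  have g0 : 0 < 1 - 6 * t%:R * gamma by rewrite subr_gt0.
  have b0 : 0 <= (1 - 6 * t%:R * gamma) * (k * #|B|)%:R by rewrite mulr_ge0 // ltW.
  move=> le; split.
    have : lam0 * S%:R == 0 by rewrite eq_le a0 andbT; lra.
    by rewrite mulf_eq0 gt_eqF //= pnatr_eq0 => /eqP.
  have : (1 - 6 * t%:R * gamma) * (k * #|B|)%:R == 0 by rewrite eq_le b0 andbT; lra.
  by rewrite mulf_eq0 gt_eqF //= pnatr_eq0 muln_eq0 gtn_eqF //= => /eqP.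
case: key => /eqP S0 /eqP B0.
have inW w : w \notin L -> w \in W.
  move=> wL; move: B0; rewrite cards_eq0 => /eqP B0.
  by apply: contraT; rewrite -B_W_L // B0 inE.
have LL w y : w \in L -> y \in L -> w != y -> adj w y.
  move=> wL yL wy; move: S0; rewrite sum_nat_eq0 => /forall_inP/(_ w wL).
  rewrite subn_eq0 => le; have E : nbhd w :&: L = L :\ w.
    apply/eqP; rewrite eqEcard; apply/andP; split.
      apply/subsetP => a; rewrite !inE => /andP[wa ->]; rewrite andbT.
      by apply: contraTneq wa => ->; rewrite adj_irrefl.
    by move: le; rewrite -cardL (cardsD1 w L) wL.
  have : y \in L :\ w by rewrite !inE eq_sym wy.
  by rewrite -E !inE => /andP[].
have [<-|uv] := eqVneq u v; first by rewrite adj_irrefl.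
case: (boolP (u \in L)) => uL; case: (boolP (v \in L)) => vL /=.
- exact: LL.
- exact: common_nbhd_adj uL (inW _ vL).
- by rewrite adj_sym; apply: common_nbhd_adj vL (inW _ uL).
- by apply/negbTE/W_indep; apply: inW.
Qed.

End Endgame.

(** * Concentration of the eigenvector on [k] vertices *)

Lemma card_many_neighbours (G : sgraph) (M : {set G}) (k t : nat) :
  (forall Y : {set G}, #|Y| = k.+1 -> #|common_nbhd Y| <= t)%N ->
  (#|[set u | k < #|nbhd u :&: M|]| <= 2 ^ #|M| * t)%N.
Proof.
move=> noK; rewrite -card_powerset -sum_nat_const -sum1_card.
apply: (@leq_trans (\sum_(Y in powerset M | #|Y| == k.+1) #|common_nbhd Y|)); last first.
  rewrite big_mkcondr /=; apply: leq_sum => Y _.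
  by case: eqP => // /noK.
under [leqRHS]eq_bigr do rewrite -sum1_card.
rewrite (exchange_big_dep predT) //= big_mkcond /=; apply: leq_sum => u _.
case: ifP => //; rewrite inE => lt.
(* Every counted vertex lies in the common neighbourhood of a subset of [M] of size [k.+1], and [M]
   has [2 ^ #|M|] subsets in all. *)
have [Y /andP[YN cY]] : exists Y : {set G}, (Y \subset nbhd u :&: M) && (#|Y| == k.+1).
  have /card_gt0P[Y] : (0 < #|[set Y : {set G} | Y \subset nbhd u :&: M & #|Y| == k.+1]|)%N.
    by rewrite cards_draws bin_gt0.
  by rewrite inE; exists Y.
rewrite (bigD1 Y) //= powersetE inE (subset_trans YN (subsetIr _ _)) cY.
by rewrite (subset_trans YN (subsetIl _ _)).
Qed.

Section Concentration.
Variables (R : realType) (G : sgraph) (k t : nat) (lam beta : R) (x : G -> R).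
Let n := #|G|.
Hypotheses (k_gt0 : (0 < k)%N) (t_gt0 : (0 < t)%N) (beta_gt0 : 0 < beta).
Hypotheses (x_bnd : forall v, 0 <= x v <= 1) (lam_gt0 : 0 < lam).
Hypothesis x_sub : forall v, lam * x v <= \sum_(w in nbhd v) x w.
Hypothesis lam_sq : k%:R * n%:R <= lam ^+ 2.
Hypothesis sparse : forall U : {set G}, (\sum_(u in U) #|nbhd u :&: U| <= 2 * t * #|U|)%N.
Hypothesis noK : forall Y : {set G}, (#|Y| = k.+1 -> #|common_nbhd Y| <= t)%N.

Let x_ge0 v : 0 <= x v. Proof. by case/andP: (x_bnd v). Qed.
Let x_le1 v : x v <= 1. Proof. by case/andP: (x_bnd v). Qed.

Let degree_sum : (\sum_(u : G) #|nbhd u| <= 2 * t * n)%N.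
Proof.
have := sparse [set: G]; rewrite cardsT; apply: leq_trans.
by apply: eq_leq; apply: eq_big => [u|u _]; rewrite ?inE // setIT.
Qed.

Let two_walks v : k%:R * n%:R * x v <= \sum_(u in nbhd v) \sum_(w in nbhd u) x w.
Proof.
apply: (@le_trans _ _ (lam * (lam * x v))).
  by rewrite mulrA -expr2 ler_wpM2r.
apply: (@le_trans _ _ (lam * \sum_(u in nbhd v) x u)).
  by rewrite ler_pM2l.
by rewrite mulr_sumr; apply: ler_sum.
Qed.

(** A two-step walk from [v] ending outside [A] contributes at most [a]; the number of such walks is
    at most the degree sum over middle vertices. *)
Let two_walks_split (A : {set G}) a v : 0 <= a -> {in ~: A, forall w, x w <= a} ->
  k%:R * n%:R * x v <=
    a * (2 * t%:R * n%:R) + \sum_(u in nbhd v) \sum_(w in nbhd u :&: A) x w.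
Proof.
move=> a0 xA; apply: le_trans (two_walks v) _.
apply: (@le_trans _ _ (\sum_(u in nbhd v) (a * #|nbhd u|%:R + \sum_(w in nbhd u :&: A) x w))).
  apply: ler_sum => u _; rewrite (big_setID A) /= addrC lerD2r.
  apply: (@le_trans _ _ (\sum_(w in nbhd u :\: A) a)).
    by apply: ler_sum => w; rewrite inE => /andP[wA _]; apply: xA; rewrite inE.
  rewrite sumr_const -[a *+ _]mulr_natr; apply: ler_wpM2l => //.
  by rewrite ler_nat; apply/subset_leq_card/subsetDl.
rewrite big_split /= lerD2r -mulr_sumr; apply: ler_wpM2l => //.
rewrite -natr_sum -!natrM ler_nat; apply: leq_trans degree_sum.
by rewrite big_mkcond; apply: leq_sum => u _; case: ifP.
Qed.

Let sum_nbhd_card (A : {set G}) (v : G) :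
  \sum_(u in nbhd v) \sum_(w in nbhd u :&: A) x w <= (\sum_(u in nbhd v) #|nbhd u :&: A|)%:R.
Proof.
rewrite natr_sum; apply: ler_sum => u _.
by rewrite -sum1_card natr_sum; apply: ler_sum.
Qed.

(** Walks ending below the threshold [alpha] carry at most a quarter of [beta * n]. Those ending in
    [A] are bounded, by sparsity of [nbhd v :|: A], by [2 * t * (#|nbhd v| + #|A|)], where [A] costs
    another quarter; the degree of [v] must supply the remaining half. *)
Let degree_of_large : 0 < n%:R :> R -> 128 * t%:R ^+ 3 <= beta ^+ 2 * lam ->
  forall v, beta <= x v -> beta * n%:R <= 4 * t%:R * #|nbhd v|%:R.
Proof.
move=> n0 lam_big v xv; pose alpha := beta / (8 * t%:R).
have t0 : 0 < t%:R :> R by rewrite ltr0n.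
have alpha0 : 0 < alpha by rewrite divr_gt0 // mulr_gt0.
have alphaE : 8 * t%:R * alpha = beta by rewrite /alpha mulrC divfK // mulf_neq0 ?gt_eqF.
pose A := [set w | alpha <= x w].
have xA : {in ~: A, forall w, x w <= alpha}.
  by move=> w; rewrite !inE -ltNge => /ltW.
(* A vertex of [A] has degree at least [alpha * lam], because [x] is at most 1. *)
have cA : #|A|%:R * (alpha * lam) <= 2 * t%:R * n%:R.
  rewrite mulr_natl -sumr_const; apply: (@le_trans _ _ (\sum_(w in A) #|nbhd w|%:R)).
    apply: ler_sum => w; rewrite inE => xw; rewrite mulrC.
    apply: (@le_trans _ _ (lam * x w)); first by rewrite ler_pM2l.
    apply: le_trans (x_sub w) _; rewrite -sum1_card natr_sum.
    by apply: ler_sum.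
  rewrite -natr_sum -!natrM ler_nat; apply: leq_trans degree_sum.
  by rewrite big_mkcond; apply: leq_sum => u _; case: ifP.
have cA' : #|A|%:R <= alpha * n%:R.
  have h : 2 * t%:R <= alpha ^+ 2 * lam.
    rewrite -(ler_pM2l (_ : 0 < 64 * t%:R ^+ 2)); last by rewrite mulr_gt0 // exprn_gt0.
    move: lam_big; rewrite -alphaE; lra.
  have h' := ler_wpM2r (ltW n0) h.
  rewrite -(ler_pM2r (_ : 0 < alpha * lam)); last by rewrite mulr_gt0.
  lra.
have hN : (\sum_(u in nbhd v) #|nbhd u :&: A| <= 2 * t * (#|nbhd v| + #|A|))%N.
  apply: (@leq_trans (\sum_(u in nbhd v :|: A) #|nbhd u :&: (nbhd v :|: A)|)).
    rewrite [leqRHS](big_setID (nbhd v)) /= setUK; apply: leq_trans (leq_addr _ _).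
    by apply: leq_sum => u _; apply/subset_leq_card/setIS/subsetUr.
  apply: leq_trans (sparse _) _; rewrite leq_mul2l; apply/orP; right.
  by rewrite cardsU leq_subr.
have := two_walks_split v (ltW alpha0) xA.
have := sum_nbhd_card A v.
rewrite -(ler_nat R) !natrM natrD in hN.
have h1 : n%:R * beta <= k%:R * n%:R * x v.
  apply: (@le_trans _ _ (n%:R * x v)); first by rewrite ler_pM2l.
  by rewrite -[leLHS]mul1r mulrA; apply: ler_wpM2r => //; apply: ler_wpM2r; rewrite ?ler1n // ltW.
have h2 : 2 * t%:R * #|A|%:R <= 2 * t%:R * (alpha * n%:R).
  by apply: ler_wpM2l => //; rewrite mulr_ge0 // ltW.
have h3 : 8 * t%:R * alpha * n%:R = beta * n%:R by rewrite alphaE.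
lra.
Qed.

Let M := [set v | beta <= x v].

(* The two-walk count through [M]: all but boundedly many vertices have at most
   [k] neighbours in [M], since [K_(k+1, t+1)] is excluded. *)
Let two_walks_M (m : nat) (U : {set G}) : (#|M| <= m)%N ->
  (m * (2 ^ m * t))%:R <= beta * n%:R ->
  \sum_(u in U) \sum_(w in nbhd u :&: M) x w <= 
  \sum_(u in U | (#|nbhd u :&: M| <= k)%N) \sum_(w in nbhd u :&: M) x w + beta * n%:R.
Proof.
move=> Mm small; rewrite (bigID (fun u => (#|nbhd u :&: M| <= k)%N)) /= lerD2l.
apply: le_trans small.
apply: (@le_trans _ _ (\sum_(u in [set u | k < #|nbhd u :&: M|]%N) m%:R)).
  rewrite big_mkcond [leRHS]big_mkcond /=; apply: ler_sum => u _.
  rewrite inE ltnNge; case: leqP => //=; rewrite ?andbF // andbT => _.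
  case: ifP => _; last by rewrite ler0n.
  apply: (@le_trans _ _ (\sum_(w in nbhd u :&: M) 1)); first by apply: ler_sum.
  rewrite sumr_const ler_nat; apply: leq_trans Mm.
  by apply/subset_leq_card/subsetIr.
rewrite sumr_const -[m%:R *+ _]mulr_natl -natrM ler_nat [leqRHS]mulnC leq_mul2r; apply/orP; right.
apply: leq_trans (card_many_neighbours M noK) _.
by rewrite leq_mul2r leq_exp2l // Mm orbT.
Qed.

Lemma concentration (m : nat) z : x z = 1 -> 0 < n%:R :> R ->
  128 * t%:R ^+ 3 <= beta ^+ 2 * lam -> 8 * t%:R ^+ 2 <= m%:R * beta ->
  (m * (2 ^ m * t))%:R <= beta * n%:R -> 
  (k <= t)%N -> 4 * t%:R * beta < 1 -> t%:R <= beta * n%:R ->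
  exists L : {set G}, [/\ #|L| = k, {in L, forall v, 1 - 4 * t%:R * beta <= x v},
    n%:R * (1 - 8 * k%:R * t%:R * beta) <= #|common_nbhd L|%:R,
    {in ~: L, forall v, x v <= 16 * t%:R ^+ 2 * beta}
    & {in ~: L, forall v, #|nbhd v :&: common_nbhd L| <= t}%N].
Proof.
move=> xz n0 lam_big m_big n_big kt beta_small n_big'.
have t0 : 0 < t%:R :> R by rewrite ltr0n.
have t1 : 1 <= t%:R :> R by rewrite ler1n.
have k1 : 1 <= k%:R :> R by rewrite ler1n.
have kt' : k%:R <= t%:R :> R by rewrite ler_nat.
(* Vertices of [M] have degree at least [beta * n / (4 * t)], and all degrees sum to at most
   [2 * t * n]. *)
have Mm : (#|M| <= m)%N.
  have h1 : #|M|%:R * (beta * n%:R) <= 4 * t%:R * (2 * t%:R * n%:R).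
    rewrite mulr_natl -sumr_const.
    apply: (@le_trans _ _ (\sum_(w in M) 4 * t%:R * #|nbhd w|%:R)).
      by apply: ler_sum => w; rewrite inE; apply: degree_of_large.
    rewrite -mulr_sumr; apply: ler_wpM2l; first by rewrite mulr_ge0.
    rewrite -natr_sum -!natrM ler_nat; apply: leq_trans degree_sum.
    by rewrite big_mkcond; apply: leq_sum => u _; case: ifP.
  rewrite -(ler_nat R) -(ler_pM2r (_ : 0 < beta * n%:R)); last by rewrite mulr_gt0.
  apply: le_trans h1 _; have := ler_wpM2r (ltW n0) m_big; lra.
have xM : {in ~: M, forall w, x w <= beta}.
  by move=> w; rewrite !inE -ltNge => /ltW.
(* Apart from an error [beta * n], middle vertices have at most [k] neighbours in [M]; dividing the
   two-walk bound by [k] bounds the degree. *)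
have deg_ge v : n%:R * (x v - 3 * t%:R * beta) <= #|nbhd v|%:R.
  have h1 := two_walks_split v (ltW beta_gt0) xM.
  have h2 := two_walks_M (nbhd v) Mm n_big.
  have h3 : \sum_(u in nbhd v | (#|nbhd u :&: M| <= k)%N) \sum_(w in nbhd u :&: M) x w
      <= k%:R * #|nbhd v|%:R.
    rewrite mulr_natr -sumr_const big_mkcondr /=; apply: ler_sum => u _.
    case: leqP => [le|_]; last by rewrite ler0n.
    apply: (@le_trans _ _ (\sum_(w in nbhd u :&: M) 1)); first by apply: ler_sum.
    by rewrite sumr_const ler_nat.
  rewrite -(ler_pM2l (_ : 0 < k%:R)); last by rewrite ltr0n.
  have h4 : 3 * (n%:R * (t%:R * beta)) <= k%:R * (3 * (n%:R * (t%:R * beta))).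
    by rewrite -[leLHS]mul1r; apply: ler_wpM2r => //; rewrite !mulr_ge0 // ltW.
  have h5 : n%:R * beta <= n%:R * (t%:R * beta).
    by rewrite ler_pM2l // -[leLHS]mul1r ler_pM2r.
  lra.
(* Averaging over the at most [n] middle vertices of walks from [z]: the errors [2 * t * beta] and
   [beta] together stay below [4 * t * beta], so some [u] sees almost the full weight [k] in [M]. *)
have [u uM su] : exists2 u, (#|nbhd u :&: M| <= k)%N &
    k%:R - 4 * t%:R * beta < \sum_(w in nbhd u :&: M) x w.
  apply: contrapT => none.
  have h1 := two_walks_split z (ltW beta_gt0) xM.
  have h2 := two_walks_M (nbhd z) Mm n_big.
  have c0 : 0 <= k%:R - 4 * t%:R * beta by lra.
  have h3 : \sum_(u in nbhd z | (#|nbhd u :&: M| <= k)%N) \sum_(w in nbhd u :&: M) x w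
      <= n%:R * (k%:R - 4 * t%:R * beta).
    apply: (@le_trans _ _ (\sum_(v : G) (k%:R - 4 * t%:R * beta))); last first.
      by rewrite sumr_const -[leLHS]mulr_natl.
    rewrite big_mkcond /=.
    apply: ler_sum => u _; case: ifP => // /andP[_ uM].
    by rewrite leNgt; apply/negP => su; apply: none; exists u.
  have h5 : n%:R * beta < n%:R * (2 * t%:R * beta).
    by rewrite ltr_pM2l // -[ltLHS]mul1r ltr_pM2r //; lra.
  rewrite xz in h1; lra.
set L := nbhd u :&: M in uM su.
have cL : #|L| = k.
  apply/eqP; rewrite eqn_leq uM /= leqNgt; apply/negP => lt.
  have : \sum_(w in L) x w <= #|L|%:R.
    by rewrite -sum1_card natr_sum; apply: ler_sum.
  have : #|L|%:R <= k%:R - 1 :> R by rewrite lerBrDr natr1 ler_nat.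
  lra.
have xL : {in L, forall v, 1 - 4 * t%:R * beta <= x v}.
  move=> v vL; move: su; rewrite (bigD1 v) //=.
  have : \sum_(w in L | w != v) x w <= k%:R - 1.
    apply: (@le_trans _ _ (\sum_(w in L | w != v) 1)); first by apply: ler_sum.
    rewrite sumr_const lerBrDr natr1 ler_nat -cL (cardD1 v L) vL add1n ltnS.
    by apply: eq_leq; apply: eq_card => w; rewrite [LHS]unfold_in /= andbC [RHS]inE.
  lra.
(* By [deg_ge] and [xL], a vertex of [L] misses at most [7 * t * beta * n] vertices; a union bound
   over [L] follows. *)
have cW : n%:R * (1 - 8 * k%:R * t%:R * beta) <= #|common_nbhd L|%:R.
  have h : (n <= #|common_nbhd L| + \sum_(w in L) #|~: nbhd w|)%N.
    rewrite /n -(cardsC (common_nbhd L)) leq_add2l.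
    apply: (@leq_trans #|\bigcup_(w in L) ~: nbhd w|).
      apply/subset_leq_card/subsetP => v; rewrite !inE => /subsetPn[w wL wv].
      by apply/bigcupP; exists w; rewrite // inE in_nbhd adj_sym -in_nbhd.
    elim/big_rec2: _ => [|w a A _ le]; first by rewrite cards0.
    by apply: leq_trans (leq_card_setU _ _) _; rewrite leq_add2l.
  have h1 : (\sum_(w in L) #|~: nbhd w|)%:R <= k%:R * (n%:R * (8 * t%:R * beta)).
    rewrite natr_sum -cL mulr_natl -sumr_const; apply: ler_sum => w wL.
    have := deg_ge w; have := xL w wL.
    have : n%:R = #|nbhd w|%:R + #|~: nbhd w|%:R :> R by rewrite -natrD cardsC.
    move=> E1 E2 E3; have := ler_wpM2l (ltW n0) E2.
    have : 0 <= n%:R * (t%:R * beta) by rewrite !mulr_ge0 // ltW.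
    lra.
  rewrite -(ler_nat R) natrD in h; lra.
have nW : {in ~: L, forall v, #|nbhd v :&: common_nbhd L| <= t}%N.
  move=> v; rewrite inE => vL.
  apply: leq_trans (noK (Y := v |: L) _); last by rewrite cardsU1 vL cL.
  apply/subset_leq_card/subsetP => w; rewrite !inE => /andP[vw LW].
  by rewrite subUset LW sub1set in_nbhd adj_sym vw.
exists L; split=> // v vL.
(* A vertex outside [L] has at most [t] neighbours in the large common neighbourhood, so its degree
   is small, and [deg_ge] turns this into a bound on [x v]. *)
have h1 := deg_ge v; have h2 := nW v vL.
have h3 : (#|nbhd v| + #|common_nbhd L| <= n + t)%N.
  rewrite -cardsUI; apply: leq_add => //; exact: max_card.
rewrite -(ler_nat R) !natrD in h3.
rewrite -(ler_pM2l n0).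
have h4 : n%:R * (k%:R * (t%:R * beta)) <= n%:R * (t%:R * (t%:R * beta)).
  by rewrite ler_pM2l //; apply: ler_wpM2r => //; rewrite mulr_ge0 // ltW.
have h5 : n%:R * (1 * (t%:R * beta)) <= n%:R * (t%:R * (t%:R * beta)).
  by rewrite ler_pM2l //; apply: ler_wpM2r => //; rewrite mulr_ge0 // ltW.
have h6 : n%:R * (1 * beta) <= n%:R * (t%:R * beta).
  by rewrite ler_pM2l //; apply: ler_wpM2r => //; rewrite ltW.
lra.
Qed.

End Concentration.

(** * The choice of constants and the conclusion *)

Lemma exists_S_graph_eigenvalue (R : realType) (n k : nat) : (0 < k)%N -> (k < n)%N ->
  exists2 lam : R, 0 < lam & lam ^+ 2 = (k%:R - 1) * lam + k%:R * (n - k)%:R.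
Proof.
move=> k0 kn; pose s : R := Num.sqrt ((k%:R - 1) ^+ 2 + 4 * (k%:R * (n - k)%:R)).
have k1 : 1 <= k%:R :> R by rewrite ler1n.
have p0 : 0 < k%:R * (n - k)%:R :> R by rewrite mulr_gt0 // ltr0n // subn_gt0.
have D0 : 0 < (k%:R - 1) ^+ 2 + 4 * (k%:R * (n - k)%:R) :> R.
  by rewrite ltr_wpDl ?sqr_ge0 // mulr_gt0.
have sE : s ^+ 2 = (k%:R - 1) ^+ 2 + 4 * (k%:R * (n - k)%:R) by rewrite sqr_sqrtr // ltW.
have s0 : 0 < s by rewrite sqrtr_gt0.
(* The larger root of the quadratic, [s] being the square root of the discriminant. *)
exists ((k%:R - 1 + s) / 2); first by rewrite divr_gt0 // ltr_wpDl // subr_ge0.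
move: sE; set p := k%:R * _; set a := k%:R - 1 => sE.
have -> : p = (s ^+ 2 - a ^+ 2) / 4 by rewrite sE; field.
by field.
Qed.

Lemma bounded_by_nat (R : realType) (a : R) : exists N : nat, a <= N%:R.
Proof. by exists (Num.truncn a).+1; apply/ltW/truncnS_gt. Qed.

Theorem theorem1p2 (R : realType) (k : nat) (hk : (8 <= k)%N) :
  exists n0 : nat, forall n : nat, (n0 <= n)%N ->
  forall G : sgraph, #|G| = n ->
    (mu R (S_graph n k) <= mu R G)%R ->
    ~ isomorphic G (S_graph n k) ->
    forall T : sgraph, tree_family k T -> contains G T.
Proof.
pose t := (2 * k + 3)%N.
have k_gt0 : (0 < k)%N by lia.
have t_gt0 : (0 < t)%N by lia.
have kt : (k <= t)%N by lia.
have t0 : 0 < t%:R :> R by rewrite ltr0n.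
have k2 : 2 <= k%:R :> R by rewrite ler_nat; lia.
have ktR : k%:R <= t%:R :> R by rewrite ler_nat.
have t1 : 1 <= t%:R :> R by rewrite ler1n.
(* Off [L] the entries will be at most [gamma = 16 * t ^ 2 * beta], and this choice gives
   [6 * t * gamma = 96 / 100 < 1]. *)
pose beta : R := (100 * t%:R ^+ 3)^-1.
have t30 : 0 < 100 * t%:R ^+ 3 :> R by rewrite mulr_gt0 // exprn_gt0.
have beta0 : 0 < beta by rewrite invr_gt0.
have betaE : 100 * t%:R ^+ 3 * beta = 1 by rewrite divff // gt_eqF.
have [m m_big] := bounded_by_nat (8 * t%:R ^+ 2 / beta).
rewrite ler_pdivrMr // in m_big.
pose Q : R := 128 * t%:R ^+ 3 / beta ^+ 2.
have [n1 n1P] := bounded_by_nat (Q ^+ 2).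
have [n2 n2P] := bounded_by_nat ((m * (2 ^ m * t))%:R / beta).
have [n3 n3P] := bounded_by_nat (t%:R / beta).
(* [n1] makes [mu] large through [mu ^ 2 >= k * n]; [n2] and [n3] make [beta * n] large;
   [4 * k + 10] is twice the size needed for the common neighbourhood of [L]; [k * t ^ 2 + k] yields
   [lam0 >= k * t]. *)
exists (n1 + n2 + n3 + (4 * k + 10) + (k * (t * t) + k))%N => n n_big G cG muG nG T TF.
apply: contrapT => nGT; apply: nG.
have kt_le : (k * (t * t) + k <= n)%N by apply: leq_trans n_big; rewrite leq_addl.
have {}n_big : (n1 + n2 + n3 + (4 * k + 10) <= n)%N by apply: leq_trans n_big; rewrite leq_addr.
have kn : (k < n)%N by have := leq_trans (leq_addl _ _) n_big; clear; lia.
have n_gt0 : 0 < n%:R :> R by rewrite ltr0n (leq_ltn_trans _ kn).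
have [lam0 lam0_gt0 lam0E] : exists2 lam : R, 0 < lam &
    lam ^+ 2 = (k%:R - 1) * lam + k%:R * (n - k)%:R.
  exact: exists_S_graph_eigenvalue.
have lam0_le : lam0 <= mu R G.
  apply: le_trans muG; apply: eigenvalue_le_mu; apply: eigenvalue_S_graph lam0E => //.
  by rewrite k_gt0 ltnW.
have lam0_ge : (k * t)%:R <= lam0.
  rewrite leNgt; apply/negP => lt.
  have : lam0 ^+ 2 < (k * t)%:R ^+ 2 by rewrite ltrXn2r // ltW.
  have : (k * t)%:R ^+ 2 <= k%:R * (n - k)%:R :> R.
    rewrite -natrX -natrM ler_nat expnS expn1 -mulnA leq_mul2l; apply/orP; right.
    by rewrite mulnCA leq_subRL 1?addnC // (leq_trans (leq_addl _ _) kt_le).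
  have : 0 <= (k%:R - 1) * lam0 by rewrite mulr_ge0 ?subr_ge0 ?ler1n // ltW.
  by rewrite lam0E; lra.
(* The term [(k - 1) * lam0] is at least [k * t], hence at least the [k ^ 2] lost in
   [k * (n - k)]. *)
have lam0_sq : k%:R * n%:R <= lam0 ^+ 2.
  rewrite lam0E (natrB _ (ltnW kn)).
  rewrite natrM in lam0_ge.
  have h1 : k%:R * k%:R <= k%:R * t%:R :> R by rewrite ler_wpM2l.
  have h2 : 1 * lam0 <= (k%:R - 1) * lam0 by rewrite ler_pM2r // lerBrDr.
  lra.
have mu0 : 0 < mu R G := lt_le_trans lam0_gt0 lam0_le.
have mu_sq : k%:R * n%:R <= mu R G ^+ 2.
  by apply: le_trans lam0_sq _; rewrite lerXn2r // nnegrE ltW.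
have n_sum : n%:R >= n1%:R + n2%:R + n3%:R + (4 * k%:R + 10) :> R.
  by rewrite -!natrM -!natrD ler_nat.
have nat_ge0 (a : nat) : 0 <= a%:R :> R := ler0n R a.
have mu_big : 128 * t%:R ^+ 3 <= beta ^+ 2 * mu R G.
  have Q0 : 0 < Q by rewrite divr_gt0 ?exprn_gt0 // mulr_gt0 // exprn_gt0.
  rewrite [leRHS]mulrC -ler_pdivrMr ?exprn_gt0 // -/Q.
  rewrite -(@ler_pXn2r R 2) // ?nnegrE ?(ltW Q0) ?(ltW mu0) //.
  apply: le_trans mu_sq; have := ler_wpM2r (ltW n_gt0) k2.
  by have := nat_ge0 n2; have := nat_ge0 n3; have := nat_ge0 k; lra.
have m_small : (m * (2 ^ m * t))%:R <= beta * n%:R.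
  rewrite [leRHS]mulrC -ler_pdivrMr //; apply: le_trans n2P _.
  by have := nat_ge0 n1; have := nat_ge0 n3; have := nat_ge0 k; lra.
have t_small : t%:R <= beta * n%:R.
  rewrite [leRHS]mulrC -ler_pdivrMr //; apply: le_trans n3P _.
  by have := nat_ge0 n1; have := nat_ge0 n2; have := nat_ge0 k; lra.
have tt_beta : t%:R * t%:R * beta <= 100^-1.
  have h : t%:R * t%:R * beta * 1 <= t%:R * t%:R * beta * t%:R.
    by rewrite ler_wpM2l // !mulr_ge0 // ltW.
  lra.
have t_beta : t%:R * beta <= 100^-1.
  apply: le_trans tt_beta; rewrite ler_pM2r // -[leLHS]mul1r ler_pM2r //.
have [x [x_bnd [z xz] x_sub]] := mu_subharmonic mu0.
have [tT cT _ _] := TF.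
have sparse (U : {set G}) : (\sum_(u in U) #|nbhd u :&: U| <= 2 * t * #|U|)%N.
  by have := edges_extremal U tT nGT; rewrite cT.
have noK (Y : {set G}) : #|Y| = k.+1 -> (#|common_nbhd Y| <= t)%N.
  by move/(tree_free_complete_bipartite k_gt0 TF nGT)/ltnW.
have [L [cL xL cW xLC nW]] : exists L : {set G},
    [/\ #|L| = k, {in L, forall v, 1 - 4 * t%:R * beta <= x v},
    #|G|%:R * (1 - 8 * k%:R * t%:R * beta) <= #|common_nbhd L|%:R,
    {in ~: L, forall v, x v <= 16 * t%:R ^+ 2 * beta}
    & {in ~: L, forall v, #|nbhd v :&: common_nbhd L| <= t}%N].
  apply: (@concentration R G k t (mu R G) beta x) xz _ _ m_big _ kt _ _ => //.
  - by rewrite cG.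
  - by rewrite cG.
  - by rewrite cG.
  - lra.
  - by rewrite cG.
apply: (isomorphic_S_graph k_gt0 cG cL).
apply: (@extremal_structure R G k t (mu R G) lam0 (16 * t%:R ^+ 2 * beta) x L) => //.
- by move=> v; case/andP: (x_bnd v).
- by rewrite !mulr_ge0 // ltW.
- by rewrite cG.
- move=> v /xL; apply: le_trans; lra.
- lra.
- apply: (tree_free_independent k_gt0 TF nGT cL).
  have k_t_beta : k%:R * t%:R * beta <= 100^-1.
    by apply: le_trans tt_beta; rewrite ler_pM2r // ler_pM2r.
  rewrite -(ler_nat R) natrD natrM; apply: le_trans cW; rewrite cG.
  have := ler_wpM2l (ltW n_gt0) k_t_beta.
  by have := nat_ge0 n1; have := nat_ge0 n2; have := nat_ge0 n3; have := nat_ge0 k; lra.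
Qed.
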